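(* Let $p$ be a prime, $q=p^m$, $n\geqslant 3$, $L=PSL_n(q)$ and $U=PSU_n(q)$. Let $k$ be a positive divisor of $m$, $q=q_0^k$ and $\beta=\varphi^{m/k}$. Then for any integer $i$ the following hold: (i) $\omega(\beta\delta^i(q)L)=k\cdot\omega(\delta^i(q_0)PSL_n(q_0))$; (ii) if $k$ is even, then $\omega(\beta\tau\delta^i(q)L)=k\cdot\omega(\delta^i(-q_0)PSU_n(q_0))$; (iii) if $k$ is odd, then $\omega(\beta\tau\delta^i(-q)U)=k\cdot\omega(\delta^i(-q_0)PSU_n(q_0))$; (iv) if $k$ is odd, then $\omega(\beta\tau\delta^i(q)L)=k\cdot\omega(\tau\delta^i(q_0)PSL_n(q_0))$; (v) $\omega(\beta\delta^i(-q)U)=k\cdot\omega(\tau\delta^i(q_0)PSL_n(q_0))$. In particular, $\omega(\tau\delta^i(q)L)=\omega(\tau\delta^i(-q)U)$.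
   Context: For a subset $X$ of a group (e.g. a coset), $\omega(X)$ is the set of orders of elements of $X$; for a set $A$ of integers, $k\cdot A=\{ka\mid a\in A\}$. Let $F$ be the algebraic closure of the field of order $p$, $H=GL_n(F)$, $\tau:g\mapsto g^{-\top}$ the inverse-transpose map of $H$, and, for a power $q$ of $p$, $\varphi_q$ the endomorphism of $H$ raising matrix entries to the $q$th power; $GL_n(q)=C_H(\varphi_q)$ and $GU_n(q)=C_H(\varphi_q\tau)$. For $\varepsilon\in\{+,-\}$ write $PSL_n^+(q)=PSL_n(q)$, $PSL_n^-(q)=PSU_n(q)$; $\delta(\varepsilon q)$ is the diagonal automorphism of $PSL_n^\varepsilon(q)$ induced by $\operatorname{diag}(\lambda,1,\dots,1)$, where $\lambda$ is a primitive $(q-\varepsilon)$th root of unity in $F_{q^2}$ (so $\delta(q)$ is for $PSL_n(q)$ and $\delta(-q)$ for $PSU_n(q)$), and $\delta^i(\varepsilon q)=\delta(\varepsilon q)^i$. $\varphi$ denotes the automorphism of $L$ or of $U$ induced by $\varphi_p$, and the automorphism induced by $\tau$ is again denoted by $\tau$ (so $\varphi^m=\tau$ on $U$). Groups $PSL_n^\varepsilon(q)$ are identified with their inner automorphism groups, and the cosets above are taken in the automorphism groups. *)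

(* Defs.v *)
From HB Require Import structures.
From mathcomp Require Import all_boot all_order all_fingroup all_algebra all_solvable.

Set Implicit Arguments.
Unset Strict Implicit.
Unset Printing Implicit Defensive.

Import GRing.Theory.
Local Open Scope ring_scope.

(* Nontrivial powers of the characteristic; there are none in characteristic 0 *)
Record char_power (F : fieldType) := CharPower {
  cp_nat :> nat;
  cp_natP : (1 < cp_nat)%N && [pchar F].-nat cp_nat
}.

Lemma pchar_expP (F : fieldType) (p m : nat) :
  p \in [pchar F] -> (0 < m)%N ->
  (1 < (p ^ m)%N)%N && [pchar F].-nat (p ^ m)%N.
Proof.
move=> pF m_gt0; have p_pr := pcharf_prime pF.
by rewrite -{1}(exp1n m) ltn_exp2r // prime_gt1 // pnatX pnatE ?pF.
Qed.

Definition frob (F : fieldType) (r : char_power F) (x : F) : F := x ^+ r.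

Lemma frob_is_zmod (F : fieldType) (r : char_power F) :
  zmod_morphism (@frob F r).
Proof.
have /andP[_ rF] := cp_natP r; move=> x y.
by rewrite /frob exprDn_pchar // exprNn_pchar.
Qed.

Lemma frob_is_monoid (F : fieldType) (r : char_power F) :
  monoid_morphism (@frob F r).
Proof. by split=> [|x y]; rewrite /frob ?expr1n ?exprMn. Qed.

HB.instance Definition _ (F : fieldType) (r : char_power F) :=
  GRing.isZmodMorphism.Build F F (@frob F r) (@frob_is_zmod F r).
HB.instance Definition _ (F : fieldType) (r : char_power F) :=
  GRing.isMonoidMorphism.Build F F (@frob F r) (@frob_is_monoid F r).

Definition phi_mx (F : fieldType) (n : nat) (r : char_power F) (g : 'M[F]_n) :
  'M[F]_n := map_mx (frob r) g.

Definition tau_mx (F : fieldType) (n : nat) (g : 'M[F]_n) : 'M[F]_n :=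
  (invmx g)^T.

Variant sign := Plus | Minus.

Definition sigma_mx (F : fieldType) (n : nat) (eps : sign) (q : char_power F)
    (g : 'M[F]_n) : 'M[F]_n :=
  if eps is Plus then phi_mx q g else phi_mx q (tau_mx g).

Section MatrixEndomorphisms.

Variables (F : fieldType) (n : nat).
Implicit Types (A B : 'M[F]_n) (q r : char_power F) (eps : sign).

Lemma invmxM A B : A \in unitmx -> B \in unitmx ->
  invmx (A *m B) = invmx B *m invmx A.
Proof.
move=> uA uB; have uAB : A *m B \in unitmx by rewrite unitmx_mul uA.
apply: (can_inj (mulKmx uAB)); rewrite mulmxV //.
by rewrite mulmxA -(mulmxA A) mulmxV // mulmx1 mulmxV.
Qed.

Lemma phi_mxM r A B : phi_mx r (A *m B) = phi_mx r A *m phi_mx r B.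
Proof. exact: map_mxM. Qed.

Lemma phi_mx_unit r A : (phi_mx r A \in unitmx) = (A \in unitmx).
Proof. exact: map_unitmx. Qed.

Lemma phi_mx_inj r : injective (@phi_mx F n r).
Proof.
by move=> A B /matrixP eqAB; apply/matrixP=> i j;
  have := eqAB i j; rewrite !mxE => /fmorph_inj.
Qed.

Lemma tau_mxM A B : A \in unitmx -> B \in unitmx ->
  tau_mx (A *m B) = tau_mx A *m tau_mx B.
Proof. by move=> uA uB; rewrite /tau_mx invmxM // trmx_mul. Qed.

Lemma tau_mx_unit A : (tau_mx A \in unitmx) = (A \in unitmx).
Proof. by rewrite /tau_mx unitmx_tr unitmx_inv. Qed.

Lemma tau_mxK : involutive (@tau_mx F n).
Proof. by move=> A; rewrite /tau_mx -trmx_inv trmxK invmxK. Qed.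

Lemma phi_tau_mx r A : phi_mx r (tau_mx A) = tau_mx (phi_mx r A).
Proof. by rewrite /phi_mx /tau_mx -map_invmx map_trmx. Qed.

Lemma phi_mxC q r A : phi_mx q (phi_mx r A) = phi_mx r (phi_mx q A).
Proof. by apply/matrixP=> i j; rewrite !mxE /frob exprAC. Qed.

Lemma sigma_mxM eps q A B : A \in unitmx -> B \in unitmx ->
  sigma_mx eps q (A *m B) = sigma_mx eps q A *m sigma_mx eps q B.
Proof.
by move=> uA uB; case: eps; rewrite /= ?tau_mxM // phi_mxM.
Qed.

Lemma sigma_mx1 eps q : sigma_mx eps q 1%:M = 1%:M :> 'M[F]_n.
Proof.
by case: eps; rewrite /= /phi_mx /tau_mx ?invmx1 ?trmx1 map_mx1.
Qed.

Lemma sigma_mxV eps q A : A \in unitmx ->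
  sigma_mx eps q (invmx A) = invmx (sigma_mx eps q A).
Proof.
by case: eps => uA /=; rewrite /phi_mx ?map_invmx // /tau_mx -map_invmx trmx_inv.
Qed.

Lemma phi_sigma_mx eps q r A :
  sigma_mx eps q (phi_mx r A) = phi_mx r (sigma_mx eps q A).
Proof. by case: eps; rewrite /= -?phi_tau_mx phi_mxC. Qed.

Lemma tau_sigma_mx eps q A :
  sigma_mx eps q (tau_mx A) = tau_mx (sigma_mx eps q A).
Proof. by case: eps; rewrite /= phi_tau_mx. Qed.

Lemma sigma_mx_expr eps q A i j :
  sigma_mx eps q A = A -> A i j ^+ (q * q) = A i j.
Proof.
move=> fixA; suff /matrixP/(_ i j) : phi_mx q (phi_mx q A) = A.
  by rewrite !mxE /frob -exprM.
case: eps fixA => /= [fixA | fixA]; first by rewrite !fixA.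
have phiA : phi_mx q A = tau_mx A by rewrite -{2}fixA phi_tau_mx tau_mxK.
by rewrite phiA.
Qed.

End MatrixEndomorphisms.

Definition in_GL (F : fieldType) (n : nat) (eps : sign) (q : char_power F) :
    pred 'M[F]_n :=
  fun g => (g \in unitmx) && (sigma_mx eps q g == g).

(* C_H(phi_q) for the sign Plus and C_H(phi_q tau) for the sign Minus. It is
   finite, because phi_{q^2} = id on it; algebraic closedness of F only serves
   to list the roots of X^(q^2) - X.                                          *)
Definition GL (F : closedFieldType) (n : nat) (eps : sign) (q : char_power F) :
  Type := {g : 'M[F]_n | in_GL eps q g}.

Section GLFinGroup.

Variables (F : closedFieldType) (n : nat) (eps : sign) (q : char_power F).
Local Notation GL := (GL n eps q).

HB.instance Definition _ := SubChoice.on GL.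

Definition GL_roots : seq F :=
  sval (closed_field_poly_normal ('X^(q * q) - 'X : {poly F})).

Lemma mem_GL_roots (g : GL) i j : val g i j \in GL_roots.
Proof.
have [/= _ /eqP/sigma_mx_expr gq] := andP (valP g).
have q2_gt1 : (1 < q * q)%N.
  by have /andP[q_gt1 _] := cp_natP q; rewrite (leq_trans q_gt1) ?leq_pmulr ?(ltnW q_gt1).
have nz : 'X^(q * q) - 'X != 0 :> {poly F}.
  apply/eqP=> /(congr1 (fun p : {poly F} => p`_(q * q))).
  by rewrite coefB coefXn coefX eqxx gtn_eqF // subr0 coef0 => /eqP; rewrite oner_eq0.
rewrite /GL_roots; case: closed_field_poly_normal => /= r def_p.
rewrite -root_prod_XsubC -(rootZ _ _ (_ : lead_coef ('X^(q * q) - 'X) != 0)).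
  by rewrite -def_p rootE !hornerE ?hornerXn gq subrr.
by rewrite lead_coef_eq0.
Qed.

Definition GL_code (g : GL) : {ffun 'I_n * 'I_n -> option (seq_sub GL_roots)} :=
  [ffun ij => insub (val g ij.1 ij.2)].

Definition GL_decode (c : {ffun 'I_n * 'I_n -> option (seq_sub GL_roots)}) :
    option GL :=
  insub (\matrix_(i, j) oapp val 0 (c (i, j))).

Lemma GL_codeK : pcancel GL_code GL_decode.
Proof.
move=> g; rewrite /GL_decode (_ : (\matrix_(i, j) _) = val g) ?valK //.
by apply/matrixP=> i j; rewrite mxE ffunE /= insubT ?mem_GL_roots.
Qed.

HB.instance Definition _ : isCountable GL := PCanIsCountable GL_codeK.
HB.instance Definition _ : isFinite GL := PCanIsFinite GL_codeK.

Lemma GL_unit (g : GL) : val g \in unitmx.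
Proof. by have /andP[] := valP g. Qed.

Lemma GL_fix (g : GL) : sigma_mx eps q (val g) = val g.
Proof. by have /andP[_ /eqP] := valP g. Qed.

Lemma GL_mul_subproof (g h : GL) : in_GL eps q (val g *m val h).
Proof. by rewrite /in_GL unitmx_mul !GL_unit sigma_mxM ?GL_unit // !GL_fix /=. Qed.

Lemma GL_one_subproof : in_GL eps q (1%:M : 'M[F]_n).
Proof. by rewrite /in_GL unitmx1 sigma_mx1 /=. Qed.

Lemma GL_inv_subproof (g : GL) : in_GL eps q (invmx (val g)).
Proof. by rewrite /in_GL unitmx_inv GL_unit sigma_mxV ?GL_unit // GL_fix /=. Qed.

Definition GL_mul (g h : GL) : GL := Sub _ (GL_mul_subproof g h).
Definition GL_one : GL := Sub _ GL_one_subproof.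
Definition GL_inv (g : GL) : GL := Sub _ (GL_inv_subproof g).

Lemma GL_mulA : associative GL_mul.
Proof. by move=> g h k; apply: val_inj; rewrite /= mulmxA. Qed.

Lemma GL_mul1 : left_id GL_one GL_mul.
Proof. by move=> g; apply: val_inj; rewrite /= mul1mx. Qed.

Lemma GL_mulV : left_inverse GL_one GL_inv GL_mul.
Proof. by move=> g; apply: val_inj; rewrite /= mulVmx ?GL_unit. Qed.

HB.instance Definition _ := Finite_isGroup.Build GL GL_mulA GL_mul1 GL_mulV.

Lemma val_GLM (g h : GL) : val (g * h)%g = val g *m val h.
Proof. by []. Qed.

Definition SL_set : {set GL} := [set g | \det (val g) == 1].

Lemma SL_group_set : group_set SL_set.
Proof.
apply/group_setP; split=> [|g h]; rewrite !inE ?det1 // => /eqP dg /eqP dh.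
by rewrite det_mulmx dg dh mulr1.
Qed.

Canonical SL := group SL_group_set.

Definition PSL : {group coset_of 'Z(SL)%g} := (SL / 'Z(SL))%G.

End GLFinGroup.

Arguments SL {F} n eps q.
Arguments PSL {F} n eps q.

(* The automorphism of S / Z(S) induced by an automorphism a of the ambient
   group that stabilises S; see Aut_induced and inducedE below.               *)
Definition induced (gT : finGroupType) (S : {group gT}) (a : {perm gT}) :
    {perm coset_of 'Z(S)%g} :=
  actperm ([Aut S] / 'Z(S))%gact (restr_perm S a).

Section Induced.

Variables (gT : finGroupType) (S : {group gT}) (a : {perm gT}).
Hypotheses (aM : {morph a : x y / (x * y)%g}) (aS : {in S, forall x, a x \in S}).

Let a_norm : a \in ('N(S | 'P))%g.
Proof. by rewrite !inE; apply/subsetP=> x Sx; rewrite inE /= aS. Qed.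

Let ra_Aut : restr_perm S a \in Aut S.
Proof.
rewrite inE restr_perm_on; apply/morphicP=> x y Sx Sy.
by rewrite !restr_permE ?groupM.
Qed.

Let ra_dom : restr_perm S a \in qact_dom ([Aut S])%gact 'Z(S)%g.
Proof.
rewrite qact_domE ?center_sub //; apply: subsetP ra_Aut.
exact: (@acts_char _ _ _ _ [Aut S]%gact _ _ _ (center_char S)).
Qed.

Lemma Aut_induced : induced S a \in Aut (S / 'Z(S))%g.
Proof. exact: (actperm_Aut ([Aut S] / 'Z(S))%gact) ra_dom. Qed.

Lemma inducedE x : x \in S ->
  induced S a (coset 'Z(S) x) = coset 'Z(S) (a x).
Proof.
move=> Sx; rewrite actpermE /= qactE ?ra_dom //=.
  by rewrite /autact /= /aperm restr_permE.
exact: subsetP (gFnorm _ _) _ Sx.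
Qed.

End Induced.

Section Automorphisms.

Variables (F : closedFieldType) (n : nat) (eps : sign) (q : char_power F).
Local Notation GL := (GL n eps q).
Local Notation SL := (SL n eps q).

Lemma phi_GL_subproof (r : char_power F) (g : GL) :
  in_GL eps q (phi_mx r (val g)).
Proof. by rewrite /in_GL phi_mx_unit GL_unit phi_sigma_mx GL_fix /=. Qed.

Definition phi_GL r (g : GL) : GL := Sub _ (phi_GL_subproof r g).

Lemma phi_GL_inj r : injective (phi_GL r).
Proof. by move=> g h /(congr1 val) /phi_mx_inj /val_inj. Qed.

Lemma tau_GL_subproof (g : GL) : in_GL eps q (tau_mx (val g)).
Proof. by rewrite /in_GL tau_mx_unit GL_unit tau_sigma_mx GL_fix /=. Qed.

Definition tau_GL (g : GL) : GL := Sub _ (tau_GL_subproof g).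

Lemma tau_GL_inj : injective tau_GL.
Proof.
by move=> g h /(congr1 val) /(can_inj (@tau_mxK _ _)) /val_inj.
Qed.

Definition q_sub_eps : nat := if eps is Plus then q.-1 else q.+1.

(* diag(l, 1, ..., 1) *)
Definition dil_mx (l : F) : 'M[F]_n :=
  diag_mx (\row_(j < n) if j == 0%N :> nat then l else 1).

Lemma dil_mx1 : dil_mx 1 = 1%:M.
Proof.
by rewrite -diag_const_mx; congr diag_mx; apply/rowP=> j; rewrite !mxE if_same.
Qed.

Lemma dil_mxM l k : dil_mx l *m dil_mx k = dil_mx (l * k).
Proof.
rewrite mulmx_diag; congr diag_mx; apply/rowP=> j; rewrite !mxE.
by case: ifP; rewrite ?mulr1.
Qed.

Lemma phi_dil_mx (r : char_power F) l : phi_mx r (dil_mx l) = dil_mx (l ^+ r).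
Proof.
rewrite /phi_mx map_diag_mx; congr diag_mx; apply/rowP=> j; rewrite !mxE.
by case: ifP; rewrite ?rmorph1.
Qed.

Lemma dil_mx_unit l : l != 0 -> dil_mx l \in unitmx.
Proof.
by move=> nz_l; have [] // := @mulmx1_unit _ _ (dil_mx l) (dil_mx l^-1);
  rewrite dil_mxM divff ?dil_mx1.
Qed.

Lemma tau_dil_mx l : l != 0 -> tau_mx (dil_mx l) = dil_mx l^-1.
Proof.
move=> nz_l; rewrite /tau_mx (_ : invmx _ = dil_mx l^-1) ?tr_diag_mx //.
apply: (can_inj (mulKmx (dil_mx_unit nz_l))).
by rewrite mulmxV ?dil_mx_unit // dil_mxM divff // dil_mx1.
Qed.

Lemma delta_GL_subproof (l : F) :
  q_sub_eps.-primitive_root l -> in_GL eps q (dil_mx l).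
Proof.
have /andP[/ltnW q_gt0 _] := cp_natP q => pr_l; have l1 := prim_expr_order pr_l.
have nz_l : l != 0.
  apply: contra_eq_neq l1 => ->; rewrite expr0n gtn_eqF ?(prim_order_gt0 pr_l) //.
  by rewrite eq_sym oner_neq0.
rewrite /in_GL dil_mx_unit //=; apply/eqP; move: l1; rewrite /q_sub_eps.
case: eps => /= l1; rewrite ?tau_dil_mx // phi_dil_mx; congr dil_mx.
  by rewrite -(prednK q_gt0) exprS l1 mulr1.
by rewrite exprVn; apply: (mulfI (expf_neq0 q nz_l)); rewrite mulfV ?expf_neq0 // -exprSr.
Qed.

Definition delta_GL (l : F) (hl : q_sub_eps.-primitive_root l) : GL :=
  Sub _ (delta_GL_subproof hl).

Definition phi (r : char_power F) : {perm coset_of 'Z(SL)%g} :=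
  induced SL (perm (phi_GL_inj (r := r))).

Definition tau : {perm coset_of 'Z(SL)%g} := induced SL (perm tau_GL_inj).

Definition delta (l : F) (hl : q_sub_eps.-primitive_root l) :
    {perm coset_of 'Z(SL)%g} :=
  induced SL (actperm 'J (delta_GL hl)).

Let induced_GL (a : {perm GL}) :
  {morph a : g h / (g * h)%g} -> (forall g, \det (val g) = 1 -> \det (val (a g)) = 1) ->
  induced SL a \in Aut (PSL n eps q) /\
  {in SL, forall g, induced SL a (coset _ g) = coset _ (a g)}.
Proof.
move=> aM adet; have aS : {in SL, forall g, a g \in SL}.
  by move=> g; rewrite !inE => /eqP/adet/eqP.
by split=> [|g]; [apply: Aut_induced | apply: inducedE].
Qed.

Lemma phiP (r : char_power F) : phi r \in Aut (PSL n eps q) /\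
  {in SL, forall g, phi r (coset _ g) = coset _ (phi_GL r g)}.
Proof.
have [] := induced_GL (a := perm (phi_GL_inj (r := r))).
- by move=> g h; rewrite !permE; apply: val_inj; rewrite /= phi_mxM.
- by move=> g dg; rewrite permE /= det_map_mx dg rmorph1.
by split=> // g Sg; rewrite -[phi_GL r g](permE (@phi_GL_inj r)); auto.
Qed.

Lemma tauP : tau \in Aut (PSL n eps q) /\
  {in SL, forall g, tau (coset _ g) = coset _ (tau_GL g)}.
Proof.
have [] := induced_GL (a := perm tau_GL_inj).
- by move=> g h; rewrite !permE; apply: val_inj; rewrite /= tau_mxM ?GL_unit.
- by move=> g dg; rewrite permE /= det_tr det_inv dg invr1.
by split=> // g Sg; rewrite -[tau_GL g](permE tau_GL_inj); auto.
Qed.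

Lemma deltaP (l : F) (hl : q_sub_eps.-primitive_root l) :
  delta hl \in Aut (PSL n eps q) /\
  {in SL, forall g, delta hl (coset _ g) = coset _ (g ^ delta_GL hl)%g}.
Proof.
have [] := induced_GL (a := actperm 'J (delta_GL hl)).
- by move=> g h; rewrite !actpermE /= conjMg.
- move=> g dg; rewrite actpermE -[act _ _ _]/(g ^ delta_GL hl)%g conjgE !val_GLM !det_mulmx dg mul1r.
  by rewrite -det_mulmx -val_GLM mulVg det1.
by split=> // g Sg; rewrite -[(g ^ _)%g](actpermE 'J); auto.
Qed.

End Automorphisms.

Arguments q_sub_eps {F} eps q.
Arguments phi {F} n eps q r.
Arguments tau {F} n eps q.
Arguments delta {F} n {eps q l} hl.

Lemma phi_exp_tau (F : closedFieldType) (n m : nat) (p q : char_power F) :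
  q = (p ^ m)%N :> nat -> (phi n Minus q p ^+ m)%g = tau n Minus q.
Proof.
move=> qE; have [Aphi phiE] := phiP n Minus q p.
have [Atau tauE] := tauP n Minus q.
apply: (eq_Aut (groupX m Aphi) Atau) => _ /morphimP[g Ng Sg ->].
rewrite tauE // permX.
have iterE j : iter j (phi n Minus q p) (coset _ g) =
    coset _ (iter j (phi_GL p) g) /\ iter j (phi_GL p) g \in SL n Minus q.
  elim: j => [|j [IH1 IH2]]; rewrite ?iterS //=; split; first by rewrite IH1 phiE.
  by move: IH2; rewrite !inE => /eqP d1; rewrite /= det_map_mx d1 rmorph1.
have [-> _] := iterE m; congr coset; apply: val_inj => /=.
have iterM j : val (iter j (phi_GL p) g) = map_mx (fun x => x ^+ (p ^ j)%N) (val g).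
  elim: j => [|j IH]; first by apply/matrixP=> a b; rewrite mxE expn0 expr1.
  by rewrite iterS /= IH; apply/matrixP=> a b; rewrite !mxE /frob -exprM expnSr.
rewrite [LHS]iterM -qE -[RHS]/(tau_mx (val g)) -{2}(GL_fix g) /= phi_tau_mx tau_mxK.
by [].
Qed.

Definition Inn (gT : finGroupType) (G : {group gT}) : {group {perm gT}} :=
  (conj_aut G @* G)%G.

Definition expgz (gT : finGroupType) (x : gT) (i : int) : gT :=
  match i with Posz j => (x ^+ j)%g | Negz j => (x ^- j.+1)%g end.

(* Finite sets of natural numbers are sequences, compared with =i *)
Definition omega (gT : finGroupType) (X : {set gT}) : seq nat :=
  [seq #[x]%g | x in X].

Definition dilate (k : nat) (A : seq nat) : seq nat := [seq (k * a)%N | a <- A].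

(* Main.v *)
(* Let F1 and F2 be commuting Frobenius-type endomorphisms of H = GL_n(F) with
   F1 = F2^k or F1 = F2^k tau.  By Lang's theorem an element u fixed by F1 can be
   written u = F2(a)^-1 a, and then v = F1(a) a^-1 is fixed by F2.  Conjugation by
   a turns s |-> u^-1 F2(s) u into F2 and F1 into s |-> v^-1 F1(s) v, so the k-th
   power of the automorphism F2 u of PSL (over F1) corresponds to the automorphism
   F1 v of PSL (over F2), and the orders differ by the factor k; on the fixed
   points of F2, F1 is the identity or tau.  If alpha = det a, then
   det u = alpha / F2(alpha) and det v = F1(alpha) / alpha, so cosets of inner
   automorphisms correspond, up to the choice of a primitive root when F1 = F2^k
   and up to squares of determinants when F1 = F2^k tau; neither change affects
   the set of orders. *)
Require Import Defs.
From mathcomp Require Import all_boot all_order all_fingroup all_algebra all_solvable.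
From mathcomp Require Import separable finfield ring.

Set Implicit Arguments.
Unset Strict Implicit.
Unset Printing Implicit Defensive.

Import GroupScope GRing.Theory.
Local Open Scope group_scope.

(** * Lang's theorem *)

(** All items are instances of [omega_descent], stated for two signs [eps], [eps0] and governed by
    the bit [e], equal to [neg eps (+) (neg eps0 && odd k)]: it records whether F1 agrees on the
    fixed points of F2 with the identity or with tau. The final equality is the case k = 1 with
    opposite signs, and (iv) also uses that equality over q0, because its descent lands in a unitary
    group. The obstacle is that orders are measured in the automorphism group of PSL, while F1 and
    F2 act on matrices. The [fidelity] lemmas bridge this: if a field-graph map followed by
    conjugation by b is trivial on SL modulo scalars, then b is scalar and the map fixes a primitive
    root. Here n >= 3 matters, since for n = 2 inverse-transpose is inner. Testing one primitive
    root then forces k to divide the exponent j, with j / k even when [e] holds. Under these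
    constraints the j-th power over F1 and the (j / k)-th power over F2 are trivial by one and the
    same condition, that a^-1 F1^(j/k)(a) is scalar; this is the source of the factor k. Lifting
    from F2 back to F1 has a further difficulty: a Lang solution has an uncontrolled determinant,
    and must be corrected by a diagonal matrix fixed by F1. *)

Section FrobeniusPowers.

Local Open Scope ring_scope.

Variables (F : closedFieldType) (q : char_power F).

Lemma cp_gt1 : (1 < q)%N.
Proof. by have /andP[] := cp_natP q. Qed.

Lemma cp_pnat : [pchar F].-nat q.
Proof. by have /andP[] := cp_natP q. Qed.

Lemma cp_exp_subproof N : (0 < N)%N ->
  (1 < q ^ N)%N && [pchar F].-nat (q ^ N)%N.
Proof.
by move=> N_gt0; rewrite pnatX cp_pnat -{1}(exp1n N) ltn_exp2r // cp_gt1.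
Qed.

Definition cp_exp N (N_gt0 : (0 < N)%N) : char_power F :=
  CharPower (cp_exp_subproof N_gt0).

Lemma expr_q_iterM (x : F) N M : x ^+ (q ^ N) = x -> x ^+ (q ^ (N * M)) = x.
Proof.
by move=> xN; elim: M => [|M IH]; rewrite ?muln0 ?expr1 // mulnS expnD exprM xN.
Qed.

(** The list plays the role of the subfield of order q^M; the roots are distinct because X^(q^M) - X
    has derivative -1. *)
Lemma cp_roots M : (0 < M)%N ->
  {rs : seq F | [/\ uniq rs, size rs = (q ^ M)%N
                  & forall x, (x \in rs) = (x ^+ (q ^ M) == x)]}.
Proof.
move=> M_gt0; pose Q := cp_exp M_gt0.
have Q_gt1 : (1 < q ^ M)%N by have /andP[] := cp_natP Q.
pose P : {poly F} := 'X^(q ^ M) - 'X.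
have szP : size P = (q ^ M).+1.
  by rewrite size_polyDl size_polyXn // size_polyN size_polyX ltnS.
have lcP : lead_coef P = 1.
  by rewrite lead_coefE szP coefB coefXn coefX eqxx gtn_eqF // subr0.
have [rs defP] := closed_field_poly_normal P.
rewrite lcP scale1r in defP.
exists rs; split=> [||x].
- rewrite -separable_prod_XsubC -defP unlock /separable_poly /P derivB derivXn derivX.
  have -> : 'X^((q ^ M).-1) *+ (q ^ M) = 0 :> {poly F}.
    have /andP[_ Qn] := cp_natP Q; have := pdiv_dvd (q ^ M).
    have pQ : pdiv (q ^ M) \in [pchar F].
      by have /pnatP := Qn; apply; rewrite ?pdiv_prime ?pdiv_dvd // ltnW.
    move=> /dvdnP[c ->].
    by rewrite -mulr_natr -polyC_natr natrM (pcharf0 pQ) mulr0 mulr0.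
  by rewrite sub0r -(scaleN1r 1) coprimepZr ?oppr_eq0 ?oner_neq0 // coprimep1.
- have := szP; rewrite defP size_prod_XsubC; case=> //.
- by rewrite -root_prod_XsubC -defP rootE !hornerE subr_eq0.
Qed.

Lemma expr_q_inj N : injective (fun x : F => x ^+ (q ^ N)).
Proof.
case: N => [|N] x y; first by rewrite !expr1.
exact: (fmorph_inj (frob (cp_exp (ltn0Sn N)))).
Qed.

End FrobeniusPowers.

(** The iterated q-th powers of [x] are all roots of [P], whose coefficients lie in the prime field.
    Among [size P] of them two coincide, and injectivity of Frobenius cancels the smaller
    iterate. *)
Lemma algebraic_fixed_frob (F : closedFieldType) (p q : char_power F) (m : nat)
    (iota : {rmorphism 'F_p -> F}) (x : F) :
  prime p -> q = (p ^ m)%N :> nat -> algebraicOver iota x ->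
  exists2 N, (0 < N)%N & (x ^+ (q ^ N) = x)%R.
Proof.
move=> p_pr qE [P nzP Px].
have Fp_fix (c : 'F_p) : (c ^+ q = c)%R.
  rewrite {}qE; elim: m => [|j IH]; first by rewrite expr1.
  by have := expf_card c; rewrite card_Fp // expnSr exprM IH.
have frobP : map_poly (frob q) (map_poly iota P) = map_poly iota P.
  rewrite -map_poly_comp; apply: eq_map_poly => c /=.
  by rewrite /frob -rmorphXn Fp_fix.
pose s := mkseq (fun i => (x ^+ (q ^ i))%R) (size P).
have /uniqPn : ~~ uniq s.
  apply/negP=> Us; have := @max_poly_roots _ (map_poly iota P) s.
  rewrite map_poly_eq0 nzP size_map_poly size_mkseq ltnn Us => H.
  suff sP : all (root (map_poly iota P)) s by have := H isT sP isT.
  apply/allP=> _ /mapP[i _ ->]; elim: i => [|i IH]; first by rewrite expr1.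
  rewrite expnSr exprM -[(_ ^+ q)%R]/(frob q _) -frobP.
  by rewrite rootE horner_map (rootP IH) rmorph0.
case/(_ 0%R)=> i [j [lt_ij lt_j]]; rewrite size_mkseq in lt_j.
rewrite !nth_mkseq ?(ltn_trans lt_ij) // => eq_ij.
exists (j - i)%N; first by rewrite subn_gt0.
apply: (@expr_q_inj _ q i).
by rewrite -exprM -expnD subnK ?eq_ij // ltnW.
Qed.

Section LangFrobenius.

Local Open Scope ring_scope.

Variables (F : closedFieldType) (q : char_power F).
Hypothesis F_alg : forall x : F, exists2 N, (0 < N)%N & x ^+ (q ^ N) = x.

Lemma mx_fixed_frob m n (A : 'M[F]_(m, n)) :
  exists2 N, (0 < N)%N & map_mx (fun x => x ^+ (q ^ N)) A = A.
Proof.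
have /fin_all_exists2[N N_gt0 AN] (ij : 'I_m * 'I_n) := F_alg (A ij.1 ij.2).
exists (\prod_ij N ij)%N; first by rewrite prodn_gt0.
apply/matrixP=> i j; rewrite mxE (bigD1 (i, j)) //= expr_q_iterM //.
exact: (AN (i, j)).
Qed.

Variables (n : nat) (h : 'M[F]_n).
Hypothesis h_unit : h \in unitmx.

Let T m (x : 'M[F]_(m, n)) := map_mx (frob q) x *m h.
Let G i : 'M_n := iter i (@T n) 1%:M.

Let iterT m i (x : 'M_(m, n)) :
  iter i (@T m) x = map_mx (fun y => y ^+ (q ^ i)) x *m G i.
Proof.
elim: i => [|i IH].
  by rewrite mulmx1; apply/matrixP=> a b; rewrite mxE expr1.
rewrite iterS IH /G iterS -/(G i) /T map_mxM mulmxA; congr (_ *m _ *m _).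
by apply/matrixP=> a b; rewrite !mxE /= /frob -exprM expnSr.
Qed.

Let G_unit i : G i \in unitmx.
Proof.
by elim: i => [|i IH]; rewrite ?unitmx1 // /G iterS unitmx_mul map_unitmx IH.
Qed.

(** Once the N-th Frobenius power fixes [h], it fixes every [G i], so [G (N * r)] is the r-th power
    of [G N], an element of the finite group GL_n(q^N). *)
Lemma iter_twisted_frob_order :
  exists2 M, (0 < M)%N & G M = 1%:M.
Proof.
have [N N_gt0 hN] := mx_fixed_frob h.
have Gfix i : map_mx (frob (cp_exp q N_gt0)) (G i) = G i.
  elim: i => [|i IH]; first exact: map_mx1.
  rewrite /G iterS -/(G i) map_mxM [X in _ *m X = _]hN; congr (_ *m _).
  by rewrite -{2}IH; apply/matrixP=> a b; rewrite !mxE /= /frob exprAC.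
have GNin : in_GL Plus (cp_exp q N_gt0) (G N).
  by rewrite /in_GL G_unit /= /phi_mx Gfix.
pose gN : GL n Plus (cp_exp q N_gt0) := Sub _ GNin.
have GX r : val (gN ^+ r)%g = G (N * r).
  elim: r => [|r IH]; first by rewrite muln0.
  by rewrite expgSr val_GLM IH mulnS /G iterD -/(G (N * r)) iterT; rewrite [map_mx _ _]Gfix.
exists (N * #[gN]%g)%N; first by rewrite muln_gt0 N_gt0 order_gt0.
by rewrite -GX expg_order.
Qed.

(* Hilbert's Theorem 90: the traces sum_i T^i(c e_j) are fixed by T, and they
   span by Dedekind's independence of the powers of Frobenius. *)
Lemma twisted_frob_basis :
  exists2 a : 'M_n, a \in unitmx & map_mx (frob q) a *m h = a.
Proof.
have [M M_gt0 GM] := iter_twisted_frob_order.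
have [rs [Urs sz_rs rsP]] := cp_roots q M_gt0.
pose I := ('I_(size rs) * 'I_n)%type.
pose b (x : 'rV_n) := \sum_(i < M) iter i (@T 1) x.
pose e (t : I) : 'rV_n := rs`_t.1 *: delta_mx 0 t.2.
have Tb t : T (b (e t)) = b (e t).
  have TD : T (b (e t)) = \sum_(i < M) iter i.+1 (@T 1) (e t).
    by rewrite /T /b raddf_sum mulmx_suml.
  rewrite TD /b; case: M M_gt0 GM rs sz_rs rsP @I @b @e t TD {Urs} => // M _ GM rs sz rsP I b e t _.
  rewrite big_ord_recr big_ord_recl /= addrC; congr (_ + _).
  rewrite -iterS iterT GM mulmx1; apply/rowP=> j; rewrite !mxE.
  have := mem_nth 0 (ltn_ord t.1); rewrite rsP => /eqP rt.
  by case: (_ && _); rewrite ?mulr1 ?mulr0 ?expr0n ?expn_eq0 ?(gtn_eqF (ltnW (cp_gt1 q))).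
pose B : 'M_(#|{: I}|, n) := \matrix_t b (e (enum_val t)).
have rB : row_full B.
  rewrite -cokermx_eq0; apply/eqP/matrixP=> j j'; rewrite [RHS]mxE.
  set u := col j' (cokermx B).
  have Bu t : b (e t) *m u = 0.
    have -> : b (e t) = row (enum_rank t) B by rewrite rowK enum_rankK.
    by rewrite /u colE mulmxA -row_mul mulmx_coker row0 mul0mx.
  pose d i : F := ((delta_mx 0 j : 'rV_n) *m G i *m u) 0 0.
  (* A column [u] killed by all traces makes this polynomial vanish at q^M points, although its
     degree is at most q^(M-1). Its coefficient of X is the [j]-th entry of [u], because [G 0] is
     the identity. *)
  pose P : {poly F} := \sum_(i < M) d i *: 'X^(q ^ i).
  have P0 : P = 0.
    apply/eqP; apply: contraT => nzP.
    have rP : all (root P) rs.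
      apply/allP=> c /(nthP 0)[k lt_k <-].
      have /(congr1 (fun A : 'M_1 => A 0 0)) := Bu (Ordinal lt_k, j).
      rewrite [RHS]mxE => Pc; apply/rootP; rewrite horner_sum -[RHS]Pc.
      rewrite /b mulmx_suml summxE; apply: eq_bigr => i _.
      rewrite !hornerE iterT /d /e /= mulrC.
      rewrite (_ : map_mx _ _ = rs`_k ^+ (q ^ i) *: delta_mx 0 j).
        by rewrite -!scalemxAl [RHS]mxE.
      apply/rowP=> j0; rewrite !mxE.
      by case: (_ && _); rewrite ?mulr1 ?mulr0 ?expr0n ?expn_eq0 ?(gtn_eqF (ltnW (cp_gt1 q))).
    have := max_poly_roots nzP rP Urs; rewrite sz_rs ltnNge => /negP[].
    apply: (leq_trans (size_sum _ _ _)); apply/bigmax_leqP=> i _.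
    apply: (leq_trans (size_scale_leq _ _)).
    by rewrite size_polyXn ltn_exp2l ?cp_gt1.
  have := congr1 (fun R : {poly F} => R`_1) P0; rewrite coef0 coef_sum.
  rewrite (bigD1 (Ordinal M_gt0)) //= coefZ coefXn expn0 eqxx mulr1 big1.
    by rewrite addr0 /d /= mulmx1 -rowE !mxE.
  move=> i /eqP ne_i; rewrite coefZ coefXn; case: (posnP i) => [i0 | i_gt0].
    by case: ne_i; apply: val_inj.
  by rewrite ltn_eqF ?mulr0 // -{1}(expn0 q) ltn_exp2l ?cp_gt1.
exists (rowsub (fullrankfun rB) B); first exact: fullrowsub_unit.
apply/row_matrixP=> i; rewrite row_mul -map_row row_rowsub rowK.
exact: Tb.
Qed.

End LangFrobenius.


Lemma lang_phi (F : closedFieldType) (q : char_power F)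
    (F_alg : forall x : F, exists2 N, (0 < N)%N & (x ^+ (q ^ N) = x)%R)
    n (g : 'M[F]_n) :
  g \in unitmx -> exists2 a, a \in unitmx & phi_mx q a = (a *m g)%R.
Proof.
move=> ug; have uh : invmx g \in unitmx by rewrite unitmx_inv.
have [a ua aE] := twisted_frob_basis F_alg uh.
by exists a => //; rewrite -[in RHS]aE mulmxKV.
Qed.

Lemma unitmx_col_neq0 (F : fieldType) n (A : 'M[F]_n) j :
  A \in unitmx -> exists i, (A i j != 0)%R.
Proof.
move=> uA; apply/existsP; apply: contraT => /existsPn A0.
have : col j A = 0%R by apply/colP=> i; rewrite !mxE; apply/eqP/negbNE/A0.
rewrite colE => /(congr1 (mulmx (invmx A))); rewrite mulKmx // mulmx0.
by move=> /matrixP/(_ j 0%R); rewrite !mxE !eqxx => /eqP; rewrite oner_eq0.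
Qed.

(** * Hermitian forms over the field of order q^2 *)

Section Hermitian.

Local Open Scope ring_scope.

Variables (F : closedFieldType) (q : char_power F).

Definition star m n (A : 'M[F]_(m, n)) : 'M_(n, m) := (map_mx (frob q) A)^T.

Lemma star_mul m n r (A : 'M_(m, n)) (B : 'M_(n, r)) :
  star (A *m B) = star B *m star A.
Proof. by rewrite /star map_mxM trmx_mul. Qed.

Lemma star_block m1 m2 n1 n2 (A : 'M_(m1, n1)) (B : 'M_(m1, n2))
    (C : 'M_(m2, n1)) (D : 'M_(m2, n2)) :
  star (block_mx A B C D) = block_mx (star A) (star C) (star B) (star D).
Proof. by rewrite /star map_block_mx tr_block_mx. Qed.

Lemma star1 n : star (1%:M : 'M_n) = 1%:M.
Proof. by rewrite /star map_mx1 trmx1. Qed.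

Lemma star0 m n : star (0 : 'M_(m, n)) = 0.
Proof. by rewrite /star map_mx0 trmx0. Qed.

Lemma star_unit n (A : 'M_n) : (star A \in unitmx) = (A \in unitmx).
Proof. by rewrite unitmx_tr map_unitmx. Qed.

Lemma nth_root_exists (d : nat) (c : F) : (0 < d)%N -> exists x : F, x ^+ d = c.
Proof.
case: d => // d _; have [x xE] := @solve_monicpoly F d.+1 (fun i => c *+ (i == 0%N)) isT.
exists x; rewrite xE big_ord_recl /= mulr1 big1 ?addr0 // => i _.
by rewrite mul0r.
Qed.

(** An element of trace 1 replaces 1/2, so that characteristic 2 is covered as well. *)
Lemma trace1_exists : exists2 s : F, s + s ^+ q = 1 & s ^+ q ^+ q = s.
Proof.
have q_gt1 := cp_gt1 q.
have [s sE] := @solve_monicpoly F q (fun i => if i is 0%N then 1 else - (i == 1%N)%:R) (ltnW q_gt1).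
have sq : s ^+ q = 1 - s.
  rewrite {}sE; case: (cp_nat q) q_gt1 => [|[|d]] // _.
  rewrite !big_ord_recl /= big1 => [|i _]; last by rewrite oppr0 mul0r.
  by rewrite expr0 expr1 mulr1 mulN1r addr0.
exists s; first by rewrite sq addrC subrK.
by rewrite sq -[_ ^+ q]/(frob q _) rmorphB rmorph1 /= /frob sq subKr.
Qed.

(** This supplies a nonzero pivot. If both relevant diagonal entries vanish, adding [c] times row
    [j] to row 0, and the same for columns, turns the corner into s + s^q = 1. The map [star] is
    involutive only on matrices over the field of order q^2; the condition on [P] is what keeps
    [P *m M *m star P] Hermitian. *)
Lemma star_isotropic n (M : 'M_n.+1) :
  M \in unitmx -> star M = M ->
  exists P : 'M_n.+1, [/\ P \in unitmx, star (star P) = P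
    & (P *m M *m star P) 0 0 != 0].
Proof.
move=> uM hM.
have starE i j : M i j = M j i ^+ q by rewrite -{1}hM !mxE.
have [M00 | M00] := eqVneq (M 0 0) 0; last first.
  by exists 1%:M; rewrite unitmx1 !star1 mul1mx mulmx1.
have [j Mj0] := unitmx_col_neq0 0 uM.
have j0 : j != 0 by apply: contraNneq Mj0 => ->; rewrite M00.
have [Mjj | Mjj] := eqVneq (M j j) 0; last first.
  exists (tperm_mx 0 j); split.
  - by rewrite unitmx_perm.
  - by rewrite /star map_perm_mx tr_perm_mx map_perm_mx tr_perm_mx invgK.
  rewrite -xrowE /star map_perm_mx tr_perm_mx tpermV -xcolE !mxE tpermL.
  by [].
have [s s1 sqq] := trace1_exists.
pose c := s / M j 0.
have cqq : c ^+ q ^+ q = c by rewrite !exprMn !exprVn sqq -!starE.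
pose E : 'M[F]_n.+1 := c *: delta_mx 0 j.
exists (1%:M + E); split.
- suff : (1%:M + E) *m (1%:M - E) = 1%:M by case/mulmx1_unit.
  rewrite mulmxDl mul1mx mulmxBr mulmx1 addrA subrK /E -scalemxAl -scalemxAr.
  by rewrite mul_delta_mx_0 // !scaler0 subr0.
- rewrite /star -map_trmx trmxK; apply/matrixP=> a b; rewrite !mxE.
  rewrite !rmorphD !rmorphM !rmorph_nat /=; congr (_ + _ * _).
  by rewrite -!rmorphM; exact: cqq.
have -> : star (1%:M + E) = 1%:M + c ^+ q *: delta_mx j 0.
  rewrite /star map_mxD map_mx1 map_mxZ map_delta_mx linearD /= trmx1.
  by rewrite linearZ /= trmx_delta.
have MjE (x : 'M_n.+1) i : (E *m x) 0 i = c * x j i.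
  by rewrite -scalemxAl mxE -[delta_mx 0 j](mul_delta_mx (0 : 'I_1)) -mulmxA -rowE mxE big_ord1 !mxE !eqxx mul1r.
have ME (x : 'M_n.+1) i : (x *m (c ^+ q *: delta_mx j 0)) i 0 = c ^+ q * x i j.
  by rewrite -scalemxAr mxE -[delta_mx j 0](mul_delta_mx (0 : 'I_1)) mulmxA -colE mxE big_ord1 !mxE !eqxx mulr1.
have XE i : ((1%:M + E) *m M) 0 i = M 0 i + c * M j i.
  by rewrite mulmxDl mul1mx mxE MjE.
rewrite mulmxDr mulmx1 [X in X != 0]mxE ME !XE M00 Mjj mulr0 add0r addr0 (starE 0).
rewrite -exprMn /c divfK // s1 oner_neq0 //.
Qed.

(** Induction by Schur complement: a nonzero pivot [c] splits off, leaving the Hermitian block [D'].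
    The pivot is written as a norm x^(q+1) = x x^q. *)
Lemma hermitian_decomposition n (M : 'M_n) :
  M \in unitmx -> star M = M ->
  exists2 d : 'M_n, d \in unitmx & M = d *m star d.
Proof.
elim: n M => [|n IH] M uM hM.
  by exists 1%:M; [exact: unitmx1 | apply/matrixP=> -[]].
have [P [uP PP M1_0]] := star_isotropic uM hM.
pose M1 : 'M_(1 + n) := P *m M *m star P.
have uM1 : M1 \in unitmx by rewrite !unitmx_mul uP uM star_unit.
have hM1 : star M1 = M1 by rewrite /M1 !star_mul PP hM mulmxA.
suff [d ud dE] : exists2 d : 'M_n.+1, d \in unitmx & M1 = d *m star d.
  exists (invmx P *m d); first by rewrite unitmx_mul unitmx_inv uP.
  rewrite star_mul mulmxA -(mulmxA _ d) -dE /M1 !mulmxA mulVmx // mul1mx.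
  by rewrite -mulmxA -star_mul mulVmx // star1 mulmx1.
have {}M1_0 : M1 0 0 != 0 by [].
clearbody M1; move: M1 uM1 hM1 M1_0 => {M uM hM P uP PP} M uM hM M00.
pose c := M 0 0; pose r : 'rV_n := ursubmx M; pose D := drsubmx M.
have ME : M = block_mx c%:M r (star r) D.
  rewrite -[LHS]submxK; congr (block_mx _ _ _ _).
    by apply/matrixP=> a b; rewrite !ord1 !mxE /c eqxx; congr (M _ _); apply: val_inj.
  by apply/matrixP=> a b; rewrite [LHS]mxE [LHS]mxE -{1}hM !mxE.
have cq : c ^+ q = c by rewrite /c -{2}hM !mxE.
have [rK hD] : star (star r) = r /\ star D = D.
  by move: hM; rewrite {1 2}ME star_block => /eq_block_mx[_ ? _ ?].
have [x xE] := nth_root_exists c (ltn0Sn q).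
have cD : star (c^-1 *: star r) = c^-1 *: r.
  by rewrite -{2}rK /star map_mxZ linearZ /= /frob exprVn cq.
pose D' := D - c^-1 *: (star r *m r).
pose E : 'M_(1 + n) := block_mx 1%:M 0 (c^-1 *: star r) 1%:M.
have EE : E *m block_mx c%:M 0 0 D' *m star E = M.
  rewrite /E star_block star1 star0 cD star1 !mulmx_block.
  rewrite !mul1mx !mul0mx !mulmx0 !mulmx1 !addr0 !add0r ME.
  rewrite mul_mx_scalar mul_scalar_mx !scalerA divff // !scale1r.
  by rewrite -scalemxAr /D' addrC subrK.
have detb (a : F) (A : 'M_n) : \det (block_mx a%:M 0 0 A : 'M_(1 + n)) = a * \det A.
  by rewrite det_lblock det_scalar1.
have uE : E \in unitmx by rewrite unitmxE /E det_lblock !det1 mulr1 unitr1.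
have hD' : star D' = D'.
  rewrite /D' /star map_mxB linearB /= -/(star D) hD map_mxZ linearZ /=.
  by rewrite -/(star _) star_mul rK /frob exprVn cq.
have uD' : D' \in unitmx.
  have : E *m block_mx c%:M 0 0 D' *m star E \in unitmx by rewrite EE.
  rewrite !unitmx_mul => /andP[/andP[_ +] _].
  by rewrite unitmxE [\det _]detb unitrM => /andP[].
have [d ud dE] := IH D' uD' hD'.
have x0 : x != 0 by apply: contraNneq M00 => x0; rewrite -/c -xE x0 expr0n.
pose Z : 'M_(1 + n) := E *m block_mx x%:M 0 0 d.
have ZE : M = Z *m star Z.
  rewrite /Z star_mul mulmxA -(mulmxA E) star_block !star0 mulmx_block -dE.
  rewrite !mulmx0 !mul0mx !addr0 add0r -[LHS]EE; congr (_ *m block_mx _ _ _ _ *m _).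
  by rewrite /star map_scalar_mx tr_scalar_mx -scalar_mxM -exprS xE.
exists Z => //.
by rewrite unitmx_mul uE unitmxE [\det _]detb unitrM -unitmxE ud andbT unitfE.
Qed.

End Hermitian.

(* A g' with g' sigma(g') = 1 is a Hermitian matrix for the twisted map
   sigma = phi_q tau, so Lang for phi_{q^2} = sigma^2 reduces the twisted case
   to the classification of Hermitian forms. *)
Lemma lang (F : closedFieldType) (q : char_power F)
    (F_alg : forall x : F, exists2 N, (0 < N)%N & (x ^+ (q ^ N) = x)%R)
    n eps (g : 'M[F]_n) :
  g \in unitmx -> exists2 a, a \in unitmx & sigma_mx eps q a = (a *m g)%R.
Proof.
case: eps => ug /=; first exact: lang_phi.
set s := fun A : 'M[F]_n => phi_mx q (tau_mx A).
have sE A : s A = sigma_mx Minus q A by [].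
have sM A B : A \in unitmx -> B \in unitmx -> s (A *m B)%R = (s A *m s B)%R.
  exact: (@sigma_mxM _ _ Minus).
have su A : (s A \in unitmx) = (A \in unitmx) by rewrite phi_mx_unit tau_mx_unit.
pose Q := cp_exp q (ltn0Sn 1).
have ss A : s (s A) = phi_mx Q A.
  rewrite /s -phi_tau_mx tau_mxK.
  by apply/matrixP=> i j; rewrite !mxE /= /frob -exprM.
have Q_alg (x : F) : exists2 N, (0 < N)%N & (x ^+ (Q ^ N) = x)%R.
  have [N N_gt0 xN] := F_alg x; exists N => //.
  by rewrite /= -expnM mulnC expr_q_iterM.
have uN : (g *m s g)%R \in unitmx by rewrite unitmx_mul ug su.
have [b ub bE] := lang_phi Q_alg uN; rewrite -ss in bE.
(* Since [s (s b)] equals [b] times the norm [g *m s g], this twisted conjugate of [g] has norm 1.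
   As [s A] is the inverse of [star A], norm 1 means being Hermitian. *)
pose g' := (b *m g *m invmx (s b))%R.
have ug' : g' \in unitmx by rewrite !unitmx_mul ub ug unitmx_inv su.
have gg' : (g' *m s g' = 1%:M)%R.
  rewrite /g' !sM ?unitmx_mul ?unitmx_inv ?su ?ub //.
  rewrite -[s (invmx _)]/(sigma_mx Minus q _) sigma_mxV ?su // -!sE.
  rewrite !mulmxA mulmxKV ?su // -(mulmxA b) -bE mulmxV // !su //.
have hg' : star q g' = g'.
  rewrite -[RHS]mulmx1 -(_ : s g' *m star q g' = 1%:M)%R; last first.
    by rewrite /s /star phi_tau_mx /tau_mx -trmx_mul mulmxV ?trmx1 // phi_mx_unit.
  by rewrite mulmxA gg' mul1mx.
have [d ud dE] := hermitian_decomposition ug' hg'.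
exists (invmx d *m b)%R; first by rewrite unitmx_mul unitmx_inv ud.
have -> : (invmx d *m b *m g = star q d *m s b)%R.
  have bg : (b *m g = g' *m s b)%R by rewrite mulmxKV ?su.
  by rewrite -mulmxA bg dE -mulmxA mulKmx.
rewrite -/(s _) sM ?unitmx_inv //; congr (_ *m _)%R.
by rewrite /s /tau_mx invmxK /phi_mx /star map_trmx.
Qed.

(** * Faithfulness on PSL *)

Lemma pnat_pos (pi : nat_pred) r : pi.-nat r -> (0 < r)%N.
Proof. by case/andP. Qed.

Section MatrixUnits.

Local Open Scope ring_scope.

Variables (F : fieldType) (n : nat).
Implicit Types (A B : 'M[F]_n) (i j l m : 'I_n).

Lemma mul_mx_delta A i j l m :
  (A *m delta_mx i j : 'M_n) l m = A l i *+ (m == j).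
Proof.
rewrite mxE (bigD1 i) //= big1 => [|t nt]; last by rewrite mxE (negPf nt) mulr0.
by rewrite mxE eqxx addr0 /= mulr_natr.
Qed.

Lemma mul_delta_mx_entry A i j l m :
  (delta_mx i j *m A : 'M_n) l m = A j m *+ (l == i).
Proof.
rewrite mxE (bigD1 j) //= big1 => [|t nt]; last by rewrite mxE (negPf nt) andbF mul0r.
by rewrite mxE eqxx andbT addr0 mulr_natl.
Qed.

Definition transvection i j (x : F) : 'M_n := 1%:M + x *: delta_mx i j.

Lemma det_transvection i j x : i != j -> \det (transvection i j x) = 1.
Proof.
have trig (k l : 'I_n) y : (l < k)%N -> \det (transvection k l y) = 1.
  move=> lt_lk; rewrite det_trig => [|].
    rewrite big1 // => a _; rewrite !mxE eqxx.
    case: eqP => [-> | _]; last by rewrite mulr0 addr0.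
    by rewrite -val_eqE (gtn_eqF lt_lk) mulr0 addr0.
  apply/is_trig_mxP=> a c lt_ac; rewrite !mxE -val_eqE (ltn_eqF lt_ac) add0r.
  case: eqP lt_ac => [-> | _ _]; last by rewrite mulr0.
  case: eqP => [-> | _ _]; last by rewrite mulr0.
  by rewrite ltnNge (ltnW lt_lk).
rewrite neq_ltn => /orP[lt_ij | lt_ji]; last exact: trig.
rewrite -det_tr linearD linearZ /= trmx1 trmx_delta; exact: trig.
Qed.

Lemma transvection_unit i j x : i != j -> transvection i j x \in unitmx.
Proof. by move=> ij; rewrite unitmxE det_transvection ?unitr1. Qed.

Lemma tau_transvection i j x : i != j ->
  tau_mx (transvection i j x) = transvection j i (- x).
Proof.
move=> ij; rewrite /tau_mx (_ : invmx _ = transvection i j (- x)).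
  by rewrite linearD linearZ /= trmx1 trmx_delta.
apply: (can_inj (mulKmx (transvection_unit x ij))).
rewrite mulmxV ?transvection_unit // /transvection mulmxDl mul1mx mulmxDr mulmx1.
rewrite -scalemxAl -scalemxAr mul_delta_mx_0 1?eq_sym // !scaler0 addr0.
by rewrite scaleNr subrK.
Qed.

(* For x = 1 or -1, the Weyl group element of SL_2 in positions i, j; unlike a
   transvection, it is unitary. *)
Definition rotation i j (x : F) : 'M_n :=
  transvection i j x *m transvection j i (- x) *m transvection i j x.

Lemma rotationE i j x : i != j -> x * x = 1 ->
  rotation i j x =
    1%:M - delta_mx i i - delta_mx j j + x *: (delta_mx i j - delta_mx j i).
Proof.
move=> ij xx; rewrite /rotation /transvection.
have ji : j != i by rewrite eq_sym.
have dd a c k l : (x *: delta_mx a c) *m delta_mx k l = x *: (delta_mx a c *m delta_mx k l) :> 'M_n.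
  by rewrite -scalemxAl.
rewrite !(mulmxDl, mulmxDr, mulmx1, mul1mx, scaleNr, mulNmx, mulmxN) -?(scalemxAl, scalemxAr).
rewrite ?(mulNmx, mulmxN, scalerN) -?(scalemxAl, scalemxAr) ?(mul_delta_mx, scalerA,xx, scale1r).
rewrite ?(mul_delta_mx_0 _ _ ij) ?(mul_delta_mx_0 _ _ ji).
rewrite mul_delta_mx_0 // sub0r mul1r scalerBr.
by apply/matrixP=> a c; rewrite !mxE; ring.
Qed.

Lemma tau_rotation i j : i != j -> tau_mx (rotation i j 1) = rotation i j 1.
Proof.
move=> ij; have ji : j != i by rewrite eq_sym.
have uT x k l : k != l -> transvection k l x \in unitmx by exact: transvection_unit.
rewrite {1}/rotation !tau_mxM ?unitmx_mul ?uT // !tau_transvection // opprK.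
have := rotationE ji (_ : (-1) * (-1) = 1 :> F); rewrite /rotation opprK => ->; last by rewrite mulrNN mulr1.
rewrite -/(rotation i j 1) rotationE ?mulr1 //.
apply/matrixP=> a c; rewrite !mxE; ring.
Qed.

Lemma det_rotation i j x : i != j -> \det (rotation i j x) = 1.
Proof.
by move=> ij; rewrite !det_mulmx !det_transvection // ?mulr1 // eq_sym.
Qed.

Lemma mul_mx_rotation A i j l m : i != j ->
  (A *m rotation i j 1) l m =
    A l m *+ ((m != i) && (m != j)) + A l i *+ (m == j) - A l j *+ (m == i).
Proof.
move=> ij; rewrite rotationE ?mulr1 // scale1r !(mulmxDr, mulmxN, mulmx1).
rewrite ![in LHS](mul_mx_delta, mxE).
have [-> | mi] := eqVneq m i; first by rewrite (negPf ij) /= ?mulr1n ?mulr0n; ring.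
by have [-> | mj] := eqVneq m j; rewrite /= ?mulr1n ?mulr0n; ring.
Qed.

Lemma mul_rotation_mx A i j l m : i != j ->
  (rotation i j 1 *m A) l m =
    A l m *+ ((l != i) && (l != j)) + A j m *+ (l == i) - A i m *+ (l == j).
Proof.
move=> ij; rewrite rotationE ?mulr1 // scale1r !(mulmxDl, mulNmx, mul1mx).
rewrite ![in LHS](mul_delta_mx_entry, mxE).
have [-> | mi] := eqVneq l i; first by rewrite (negPf ij) /= !mulr1n !mulr0n; ring.
by have [-> | mj] := eqVneq l j; rewrite /= ?mulr1n ?mulr0n; ring.
Qed.

End MatrixUnits.

Definition neg eps := if eps is Minus then true else false.

Section Fidelity.

Local Open Scope ring_scope.

Variables (F : closedFieldType) (n : nat).
Hypothesis n_ge3 : (3 <= n)%N.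

(** The exponent is a bare natural number because the zeroth iterate of a Frobenius map gives
    [r = 1], which [char_power] excludes. *)
Definition sg (c : bool) (r : nat) (A : 'M[F]_n) : 'M_n :=
  map_mx (fun x => x ^+ r) (if c then tau_mx A else A).

(** The one-dimensional counterpart of [sg]: its effect on the entries of a diagonal matrix and, for
    the maps [sigma_mx], on determinants. *)
Definition fix_sg (c : bool) (r : nat) (x : F) := (if c then x^-1 else x) ^+ r.

Lemma third_index (i j : 'I_n) : exists t, (t != i) && (t != j).
Proof.
have /card_gt0P[t] : (0 < #|~: [set i; j]|)%N.
  by rewrite cardsCs setCK card_ord subn_gt0 cards2; case: (_ == _) => //; apply: ltnW.
by rewrite !inE negb_or => tij; exists t.
Qed.

Lemma map_transvection r (i j : 'I_n) (x : F) : (0 < r)%N -> i != j ->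
  map_mx (fun y => y ^+ r) (transvection i j x) = transvection i j (x ^+ r).
Proof.
move=> r_gt0 ij; apply/matrixP=> a c; rewrite !mxE.
have r0 : (0 : F) ^+ r = 0 by rewrite expr0n (gtn_eqF r_gt0).
have [/andP[/eqP-> /eqP->] | _] := boolP ((a == i) && (c == j)).
  by rewrite (negPf ij) !mulr1 !add0r.
by rewrite !mulr0 !addr0; case: (a == c); rewrite ?expr1n ?r0.
Qed.

(** Transvections are the test elements. Each forces a column of [b] to be supported on a single
    row. If [c] were true, column [j] would be supported on row [i] for every [i != j]; for n >= 3
    there are two such rows, so the column would vanish. *)
Lemma fidelity_Plus (q : char_power F) c r (b : 'M_n) : (0 < r)%N -> b \in unitmx ->
  (forall s, \det s = 1 -> phi_mx q s = s ->
     exists z, b *m sg c r s = z *: (s *m b)) ->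
  [/\ c = false, is_scalar_mx b & forall x : F, x ^+ q = x -> x ^+ r = x].
Proof.
move=> r_gt0 ub bT; have q_gt0 := ltnW (cp_gt1 q).
have bt i j x : i != j -> x ^+ q = x ->
  exists z, b *m sg c r (transvection i j x) = z *: (transvection i j x *m b).
  move=> ij xq; apply: bT; first exact: det_transvection.
  by rewrite /phi_mx map_transvection // xq.
have b0 i j l : i != j -> l != i -> b l (if c then j else i) = 0.
  move=> ij li; have [z] := bt i j 1 ij (expr1n _ _).
  set i' := if c then j else i; pose j' := if c then i else j.
  have i'j' : i' != j' by rewrite /i' /j'; case: (c); rewrite // eq_sym.
  have [w w0 ->] : exists2 w, w != 0 & sg c r (transvection i j 1) = transvection i' j' w.
    rewrite /sg /i' /j'; case: (c); rewrite ?tau_transvection // map_transvection // 1?eq_sym //.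
      by exists ((-1) ^+ r) => //; rewrite expf_neq0 // oppr_eq0 oner_neq0.
    by exists (1 ^+ r) => //; rewrite expf_neq0 // oner_neq0.
  rewrite /transvection mulmxDr mulmx1 -scalemxAr mulmxDl mul1mx -scalemxAl.
  (* The scalar is not known in advance: if it is 1, column [j'] gives the vanishing, otherwise
     column [i'] does. *)
  move=> /matrixP bE; have [z1 | z1] := eqVneq z 1.
    have := bE l j'; rewrite z1 scale1r !(mul_mx_delta, mul_delta_mx_entry, mxE).
    rewrite eqxx (negPf li) mulr0n mulr0 addr0 => /(canRL (addKr _)).
    by rewrite addNr => /eqP; rewrite mulf_eq0 (negPf w0) => /eqP.
  have := bE l i'; rewrite !(mul_mx_delta, mul_delta_mx_entry, mxE).
  rewrite (negPf i'j') (negPf li) !mulr0n !mulr0 !addr0 => /eqP.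
  by rewrite -subr_eq0 -{1}[b l i']mul1r -mulrBl mulf_eq0 subr_eq0 eq_sym (negPf z1) => /eqP.
have i0 : 'I_n := Ordinal (ltn_trans (ltn0Sn 1) n_ge3).
case: c bt b0 {bT} => bt b0.
  have [j /andP[j0 _]] := third_index i0 i0.
  have [k /andP[k0 kj]] := third_index i0 j.
  have [l] := unitmx_col_neq0 j ub; have [-> | lk] := eqVneq l k.
    by rewrite (b0 i0 j k) ?eqxx // eq_sym.
  by rewrite (b0 k j l) ?eqxx.
have bd i l : l != i -> b l i = 0.
  by have [j /andP[ji _]] := third_index i i => li; rewrite (b0 i j) // eq_sym.
have bii i : b i i != 0.
  by have [l] := unitmx_col_neq0 i ub; have [-> | /bd->] := eqVneq l i; rewrite ?eqxx.
have bx i j x : i != j -> x ^+ q = x -> b i i * x ^+ r = x * b j j.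
  move=> ij xq; have [z] := bt i j x ij xq; rewrite /sg map_transvection //.
  rewrite /transvection mulmxDr mulmx1 -scalemxAr mulmxDl mul1mx -scalemxAl.
  move=> /matrixP bE.
  have := bE i i; have := bE i j; rewrite !(mul_mx_delta, mul_delta_mx_entry, mxE).
  rewrite !eqxx (negPf ij) !mulr1n !mulr0n !mulr0 addr0 (bd j i) // (bd i j) 1?eq_sym // !add0r mulr0 addr0.
  move=> bij /eqP; rewrite -subr_eq0 -{1}[b i i]mul1r -mulrBl mulf_eq0 (negPf (bii i)) orbF subr_eq0.
  by move=> /eqP z1; rewrite mulrC bij -z1 mul1r.
have bij i j : b i i = b j j.
  have [-> // | ij] := eqVneq i j.
  by have := bx i j 1 ij (expr1n _ _); rewrite expr1n mulr1 mul1r.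
split=> // [|x xq].
  apply/is_scalar_mxP; exists (b i0 i0); apply/matrixP=> a d; rewrite !mxE.
  have [-> | ad] := eqVneq a d; first exact: bij.
  exact: bd.
have [j /andP[j0 _]] := third_index i0 i0.
by have := bx j i0 x j0 xq; rewrite (bij j i0) mulrC => /(mulIf (bii i0)).
Qed.

Lemma tau_diag_mx (d : 'rV[F]_n) : (forall k, d 0 k != 0) ->
  tau_mx (diag_mx d) = diag_mx (\row_k (d 0 k)^-1).
Proof.
move=> d0; have dd : diag_mx d *m diag_mx (\row_k (d 0 k)^-1) = 1%:M.
  rewrite mulmx_diag -diag_const_mx; congr diag_mx.
  by apply/rowP=> k; rewrite !mxE divff.
have [ud _] := mulmx1_unit dd.
rewrite /tau_mx (_ : invmx _ = diag_mx (\row_k (d 0 k)^-1)) ?tr_diag_mx //.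
by apply: (can_inj (mulKmx ud)); rewrite mulmxV.
Qed.

Lemma sg_diag_mx c r (d : 'rV[F]_n) : (0 < r)%N -> (forall k, d 0 k != 0) ->
  sg c r (diag_mx d) = diag_mx (\row_k fix_sg c r (d 0 k)).
Proof.
move=> r_gt0 d0; rewrite /sg /fix_sg.
have mapd (e : 'rV[F]_n) : map_mx (fun y => y ^+ r) (diag_mx e) = diag_mx (\row_k e 0 k ^+ r).
  apply/matrixP=> i j; rewrite !mxE; case: eqP => [->|_]; rewrite ?mulr1n //.
  by rewrite !mulr0n expr0n (gtn_eqF r_gt0).
by case: c; rewrite ?tau_diag_mx // mapd; congr diag_mx; apply/rowP=> k; rewrite !mxE.
Qed.

Lemma mul_mx_diag_entry (A : 'M[F]_n) (d : 'rV_n) i j :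
  (A *m diag_mx d) i j = A i j * d 0 j.
Proof. by rewrite mul_mx_diag mxE. Qed.

Lemma mul_diag_mx_entry (A : 'M[F]_n) (d : 'rV_n) i j :
  (diag_mx d *m A) i j = d 0 i * A i j.
Proof. by rewrite mul_diag_mx mxE. Qed.

Lemma exprN1_pnat r : [pchar F].-nat r -> (-1) ^+ r = -1 :> F.
Proof. by move=> rF; rewrite exprNn_pchar // expr1n. Qed.

Lemma map_rotation r (i j : 'I_n) : [pchar F].-nat r -> i != j ->
  map_mx (fun y => y ^+ r) (rotation i j 1) = rotation i j 1 :> 'M[F]_n.
Proof.
move=> rF ij; rewrite rotationE ?mulr1 // scale1r; apply/matrixP=> a d; rewrite !mxE.
have r0 : (0 : F) ^+ r = 0 by rewrite expr0n (gtn_eqF (pnat_pos rF)).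
have ji : (j == i) = false by rewrite eq_sym (negPf ij).
have [-> | ai] := eqVneq a i; rewrite ?(negPf ij) ?ji /=.
  rewrite !subr0; have [-> | di] := eqVneq d i; rewrite ?(negPf ij) ?ji ?eqxx /=.
    by rewrite subrr !add0r r0.
  rewrite ?subr0 ?add0r; case: (d == j); rewrite ?expr1n ?r0 //.
have [-> | aj] := eqVneq a j; rewrite ?(negPf ij) ?ji ?eqxx /=.
  have [-> | dj] := eqVneq d j; rewrite ?(negPf ij) ?ji ?eqxx /= !subr0.
    by rewrite ?subr0 ?subrr ?add0r ?subr0 ?subrr r0.
  rewrite ?subr0 ?sub0r ?add0r; case: (d == i); rewrite ?oppr0 ?r0 //.
  exact: exprN1_pnat.
by rewrite !subr0 addr0; case: (a == d); rewrite ?expr1n ?r0.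
Qed.

(* The diagonal torus alone does not suffice: in SU_3(2) a permutation matrix of
   order 3 commutes with it modulo scalars. *)
Lemma fidelity_Minus (q : char_power F) (l : F) c r (b : 'M_n) :
  q.+1.-primitive_root l -> [pchar F].-nat r -> b \in unitmx ->
  (forall s, \det s = 1 -> sigma_mx Minus q s = s ->
     exists z, b *m sg c r s = z *: (s *m b)) ->
  is_scalar_mx b /\ fix_sg c r l = l.
Proof.
move=> pr_l rF ub bT; have q_gt1 := cp_gt1 q; have r_gt0 := pnat_pos rF.
have l0 : l != 0 by rewrite (prim_root_eq0 pr_l).
have lq : l ^+ q = l^-1.
  by apply: (mulfI l0); rewrite mulfV // -exprS prim_expr_order.
have ll : l != l^-1.
  apply/eqP=> /(congr1 ( *%R l)); rewrite mulfV // -expr2 => /eqP.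
  by rewrite -(prim_order_dvd pr_l) gtnNdvd // !ltnS.
pose d (i j : 'I_n) : 'rV[F]_n := \row_k if k == i then l else if k == j then l^-1 else 1.
have d0 i j k : d i j 0 k != 0.
  by rewrite mxE; case: ifP => // _; case: ifP; rewrite ?invr_eq0 ?oner_neq0.
have bd i j : i != j -> exists z, forall a k,
  b a k * fix_sg c r (d i j 0 k) = z * (d i j 0 a * b a k).
  move=> ij; have [||z] := bT (diag_mx (d i j)).
  - rewrite det_diag (bigD1 i) //= (bigD1 j) 1?eq_sym //= big1 => [|k /andP[ki kj]].
      by rewrite !mxE !eqxx eq_sym (negPf ij) mulr1 mulfV.
    by rewrite mxE (negPf ki) (negPf kj).
  - rewrite /= tau_diag_mx // /phi_mx map_diag_mx; congr diag_mx.
    apply/rowP=> k; rewrite !mxE /= /frob; case: ifP => _; first by rewrite exprVn lq invrK.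
    by case: ifP => _; rewrite ?invrK ?lq // invr1 expr1n.
  rewrite sg_diag_mx // => /matrixP bE; exists z => a k; have := bE a k.
  by rewrite mul_mx_diag_entry mxE [in RHS]mxE mul_diag_mx_entry.
have br i j : i != j -> exists z, forall a k,
   (b *m rotation i j 1) a k = z * (rotation i j 1 *m b) a k.
  move=> ij; have [||z bE] := bT (rotation i j 1).
  - exact: det_rotation.
  - by rewrite /= tau_rotation // /phi_mx map_rotation // cp_pnat.
  exists z => a k; transitivity ((z *: (rotation i j 1 *m b)) a k); last by rewrite mxE.
  rewrite -bE; congr ((_ *m _) _ _).
  by rewrite /sg; case: c {bT bd bE}; rewrite ?tau_rotation // map_rotation.
have fix0 x : x != 0 -> fix_sg c r x != 0.
  by move=> x0; rewrite /fix_sg; case: (c); rewrite expf_neq0 ?invr_eq0.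
(* Two nonzero entries in one column would equate the entries l and l^-1 of [d a a']; hence [b] is
   monomial. *)
have buniq a a' k : b a k != 0 -> b a' k != 0 -> a = a'.
  move=> ba ba'; apply: contraNeq ll => aa'; have [z bE] := bd a a' aa'.
  have z0 : z != 0.
    apply: contraNneq (fix0 _ (d0 a a' k)) => z0.
    by have /eqP := bE a k; rewrite z0 mul0r mulf_eq0 (negPf ba).
  have := bE a' k; rewrite [_ * fix_sg _ _ _]mulrC mulrA => /(mulIf ba').
  have := bE a k; rewrite [_ * fix_sg _ _ _]mulrC mulrA => /(mulIf ba) ->.
  by move=> /(mulfI z0) E; apply/eqP; move: E; rewrite !mxE !eqxx [a' == a]eq_sym (negPf aa').
(* The rotation in positions [a] and [t] fixes column [k] and exchanges rows [a] and [t] up to sign,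
   so a nonzero entry at (a, k) would produce a second one at (t, k), against [buniq]. *)
have bd0 a k : a != k -> b a k = 0.
  move=> ak; apply/eqP; apply: contraT => ba.
  have [t /andP[ta tk]] := third_index a k.
  have at' : a != t by rewrite eq_sym.
  have [z /(_ a k)] := br a t at'.
  rewrite mul_mx_rotation // mul_rotation_mx // eqxx (negPf at') ![k == _]eq_sym (negPf ak) (negPf tk).
  rewrite /= !mulr1n !mulr0n !addr0 !subr0 add0r => bE.
  have bt : b t k != 0 by apply: contraNneq ba => bt; rewrite bE bt mulr0.
  by move: ta; rewrite (buniq _ _ _ ba bt) eqxx.
have bii i : b i i != 0.
  by have [a] := unitmx_col_neq0 i ub; have [-> | /bd0->] := eqVneq a i; rewrite ?eqxx.
have bij i j : b i i = b j j.
  have [-> // | ij] := eqVneq i j; have [t /andP[ti tj]] := third_index i j.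
  have [z bE] := br i j ij.
  have := bE t t; rewrite mul_mx_rotation // mul_rotation_mx // ti tj (negPf ti) (negPf tj).
  rewrite !mulr1n !mulr0n !addr0 !subr0 -{1}[b t t]mul1r => /(mulIf (bii t)) z1.
  have := bE i j; rewrite mul_mx_rotation // mul_rotation_mx // !eqxx -z1 mul1r.
  by rewrite [j == i]eq_sym (negPf ij) /= !mulr1n !mulr0n !add0r !subr0.
have i0 : 'I_n := Ordinal (ltn_trans (ltn0Sn 1) n_ge3).
split.
  apply/is_scalar_mxP; exists (b i0 i0); apply/matrixP=> a k; rewrite !mxE.
  by have [-> | /bd0] := eqVneq a k; first exact: bij.
have [j /andP[j0 _]] := third_index i0 i0; have [t /andP[ti tj]] := third_index i0 j.
have i0j : i0 != j by rewrite eq_sym.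
have [z bE] := bd i0 j i0j.
have := bE t t; rewrite !mxE (negPf ti) (negPf tj) mulrC mul1r => /(mulIf (bii t)).
rewrite (_ : fix_sg c r 1 = 1) => [z1|]; last by rewrite /fix_sg; case: (c); rewrite ?invr1 expr1n.
by have := bE i0 i0; rewrite -z1 mul1r !mxE eqxx mulrC => /(mulIf (bii i0)).
Qed.

(** In the unitary case [c] cannot be recovered, because tau coincides there with the q-Frobenius
    map; only the joint effect of [c] and [r] on [l] is determined. *)
Lemma fidelity (eps : sign) (q : char_power F) (l : F) c r (b : 'M_n) :
  (q_sub_eps eps q).-primitive_root l -> [pchar F].-nat r -> b \in unitmx ->
  (forall s, \det s = 1 -> sigma_mx eps q s = s ->
     exists z, b *m sg c r s = z *: (s *m b)) ->
  [/\ is_scalar_mx b, fix_sg c r l = l & eps = Plus -> c = false].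
Proof.
case: eps => [] /= pr_l rF ub bT; last by have [? ?] := fidelity_Minus pr_l rF ub bT.
have [-> bs rE] := fidelity_Plus (pnat_pos rF) ub bT; split=> //; apply: rE.
have q_gt0 : (0 < q)%N by apply: ltnW (cp_gt1 q).
by rewrite -(prednK q_gt0) exprS (prim_expr_order pr_l) mulr1.
Qed.

End Fidelity.

(** * Iterates of twisted Frobenius maps *)

Section FrobeniusIterates.

Local Open Scope ring_scope.

Variables (F : closedFieldType) (n : nat).
Implicit Types (q : char_power F) (eps : sign) (A B a s : 'M[F]_n).

Lemma sg_sigma_mx c r eps q A :
  sg c r (sigma_mx eps q A) = sg (neg eps (+) c) (q * r) A.
Proof.
have comp B : map_mx (fun x => x ^+ r) (phi_mx q B) = map_mx (fun x => x ^+ (q * r)) B.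
  by apply/matrixP=> i j; rewrite !mxE /= /frob exprM.
by rewrite /sg; case: c; rewrite -?tau_sigma_mx; case: eps;
  rewrite /= comp ?tau_mxK.
Qed.

Lemma iter_sigma_mx eps q j A :
  iter j (sigma_mx eps q) A = sg (neg eps && odd j) (q ^ j) A.
Proof.
elim: j A => [|j IH] A.
  by rewrite andbF; apply/matrixP=> i k; rewrite mxE expr1.
rewrite iterSr IH sg_sigma_mx expnS; congr sg.
by case: (neg eps); rewrite /= ?andbF //; case: (odd j).
Qed.

Lemma iter_sigma_mxM eps q j A B : A \in unitmx -> B \in unitmx ->
  iter j (sigma_mx eps q) (A *m B) =
    iter j (sigma_mx eps q) A *m iter j (sigma_mx eps q) B.
Proof.
elim: j A B => // j IH A B uA uB; rewrite !iterSr sigma_mxM // IH //.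
  by case: (eps); rewrite /= phi_mx_unit ?tau_mx_unit.
by case: (eps); rewrite /= phi_mx_unit ?tau_mx_unit.
Qed.

Lemma sigma_mx_unit eps q A : (sigma_mx eps q A \in unitmx) = (A \in unitmx).
Proof. by case: eps; rewrite /= phi_mx_unit ?tau_mx_unit. Qed.

Lemma iter_sigma_mx_unit eps q j A :
  (iter j (sigma_mx eps q) A \in unitmx) = (A \in unitmx).
Proof. by elim: j => //= j IH; rewrite sigma_mx_unit. Qed.

Lemma iter_sigma_mxV eps q j A : A \in unitmx ->
  iter j (sigma_mx eps q) (invmx A) = invmx (iter j (sigma_mx eps q) A).
Proof.
by move=> uA; elim: j => //= j ->; rewrite sigma_mxV ?iter_sigma_mx_unit.
Qed.

(** The map [sigma_mx] transported through conjugation by [a]. Lang's theorem brings a Frobenius map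
    followed by an inner one to this form, in which iteration is transparent and no norm of the
    inner factor has to be expanded. *)
Definition conj_sigma eps q a s : 'M[F]_n :=
  invmx a *m sigma_mx eps q (a *m s *m invmx a) *m a.

Lemma iter_conj_sigma eps q a s j : a \in unitmx ->
  iter j (conj_sigma eps q a) s =
    invmx a *m iter j (sigma_mx eps q) (a *m s *m invmx a) *m a.
Proof.
move=> ua; elim: j => [|j IH] /=; first by rewrite !mulmxA mulVmx // mul1mx mulmxKV.
rewrite {1}/conj_sigma IH; congr (_ *m sigma_mx _ _ _ *m _).
by rewrite !mulmxA mulmxV // mul1mx mulmxK.
Qed.

(** The scalar [z], which may vary with [s], accounts for the quotient by the centre. *)
Definition acts_trivially eps q (f : 'M[F]_n -> 'M[F]_n) :=
  forall s, \det s = 1 -> sigma_mx eps q s = s -> exists z, f s = z *: s.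

Lemma iter_conj_sigma_unit eps q a s j : a \in unitmx -> s \in unitmx ->
  iter j (conj_sigma eps q a) s =
    (invmx a *m iter j (sigma_mx eps q) a) *m iter j (sigma_mx eps q) s
      *m invmx (invmx a *m iter j (sigma_mx eps q) a).
Proof.
move=> ua us; rewrite iter_conj_sigma // !iter_sigma_mxM ?unitmx_mul ?unitmx_inv ?ua //.
rewrite iter_sigma_mxV // invmxM ?unitmx_inv ?iter_sigma_mx_unit // invmxK.
by rewrite !mulmxA.
Qed.

Lemma det1_unit s : \det s = 1 -> s \in unitmx.
Proof. by move=> ds; rewrite unitmxE ds unitr1. Qed.

Lemma acts_trivially_sufficient eps q eps' q' a j : a \in unitmx ->
  is_scalar_mx (invmx a *m iter j (sigma_mx eps' q') a) ->
  (forall s, sigma_mx eps q s = s -> iter j (sigma_mx eps' q') s = s) ->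
  acts_trivially eps q (iter j (conj_sigma eps' q' a)).
Proof.
move=> ua /is_scalar_mxP[z zE] fixs s ds qs; exists 1.
rewrite iter_conj_sigma_unit ?(det1_unit ds) // (fixs s qs) zE scale1r -scalar_mxC.
rewrite mulmxK // -zE unitmx_mul unitmx_inv ua iter_sigma_mx_unit //.
Qed.

Hypothesis n_ge3 : (3 <= n)%N.

Lemma acts_trivially_necessary eps q eps' q' (l : F) a j : a \in unitmx ->
  (q_sub_eps eps q).-primitive_root l ->
  acts_trivially eps q (iter j (conj_sigma eps' q' a)) ->
  [/\ is_scalar_mx (invmx a *m iter j (sigma_mx eps' q') a),
      fix_sg (neg eps' && odd j) (q' ^ j) l = l
    & eps = Plus -> neg eps' && odd j = false].
Proof.
move=> ua pr_l triv; set b := invmx a *m _.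
have ub : b \in unitmx by rewrite unitmx_mul unitmx_inv ua iter_sigma_mx_unit.
apply: (fidelity n_ge3 pr_l _ ub); first by rewrite pnatX cp_pnat.
move=> s ds qs; have [z] := triv s ds qs; rewrite iter_conj_sigma_unit ?(det1_unit ds) //.
rewrite -/b => zE; exists z.
by rewrite -iter_sigma_mx scalemxAl -zE mulmxKV.
Qed.

End FrobeniusIterates.

(** * Which iterates fix a primitive root *)

Section Arithmetic.

Local Open Scope ring_scope.

Variables (F : closedFieldType) (q q0 : char_power F) (k : nat) (eps eps0 : sign).
Hypotheses (k_gt0 : (0 < k)%N) (qE : q = (q0 ^ k)%N :> nat).
Variable e : bool.
Hypothesis epsE : neg eps = (neg eps0 && odd k) (+) e.

Lemma prim_root_neq0 d (l : F) : d.-primitive_root l -> l != 0.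
Proof.
by move=> pr_l; rewrite (prim_root_eq0 pr_l) -lt0n (prim_order_gt0 pr_l).
Qed.

Lemma prim_root_neqV (r : char_power F) (l : F) : r.+1.-primitive_root l -> l != l^-1.
Proof.
move=> pr_l; have l0 := prim_root_neq0 pr_l; have r_gt1 := cp_gt1 r.
apply/eqP=> /(congr1 ( *%R l)); rewrite mulfV // -expr2 => /eqP.
by rewrite -(prim_order_dvd pr_l) gtnNdvd // !ltnS.
Qed.

Lemma fix_sg_inv (r : nat) (l : F) c t : l ^+ r = l^-1 ->
  fix_sg c (r ^ t) l = if c (+) odd t then l^-1 else l.
Proof.
move=> lr; have lt : l ^+ (r ^ t) = if odd t then l^-1 else l.
  elim: t => [|t IH]; first by rewrite expr1.
  by rewrite expnSr exprM IH /=; case: (odd t); rewrite /= ?exprVn lr ?invrK.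
by rewrite /fix_sg; case: c; rewrite ?exprVn lt; case: (odd t); rewrite /= ?invrK.
Qed.

Lemma prim_root_Plus (r : char_power F) (l : F) : r.-1.-primitive_root l -> l ^+ r = l.
Proof.
move=> pr_l; rewrite -(prednK (ltnW (cp_gt1 r))) exprS (prim_expr_order pr_l).
exact: mulr1.
Qed.

Lemma prim_root_Minus (r : char_power F) (l : F) : r.+1.-primitive_root l -> l ^+ r = l^-1.
Proof.
move=> pr_l; have l0 := prim_root_neq0 pr_l.
by apply: (mulfI l0); rewrite mulfV // -exprS prim_expr_order.
Qed.

(** For [Plus], l^(q0^r) = l with 0 < r < k would make q - 1 divide the smaller number q0^r - 1. For
    [Minus], q0 has order 2k modulo q + 1, whence 2k divides 2j; the parity of j / k is then read
    off from whether [l] goes to l or to l^-1. *)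
Lemma fix_sg_dvd (l : F) j :
  (q_sub_eps eps q).-primitive_root l ->
  fix_sg (neg eps0 && odd j) (q0 ^ j) l = l ->
  (eps = Plus -> neg eps0 && odd j = false) ->
  (k %| j)%N && ~~ (e && odd (j %/ k)).
Proof.
have q0_gt1 := cp_gt1 q0; have q0_gt0 := ltnW q0_gt1.
case: eps epsE => /= eE pr_l.
  move=> fixl /(_ erefl) c0; move: fixl; rewrite c0 /fix_sg => lj.
  have lq : l ^+ (q0 ^ k) = l by rewrite -qE prim_root_Plus.
  have lr : l ^+ (q0 ^ (j %% k)) = l.
    rewrite -{2}lj {2}(divn_eq j k) expnD exprM mulnC expr_q_iterM //.
  have kj : (k %| j)%N.
    rewrite /dvdn; case: (posnP (j %% k)) => // r_gt0; exfalso.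
    have := ltn_pmod j k_gt0; rewrite ltnNge => /negP[].
    have l1 : l ^+ (q0 ^ (j %% k)).-1 == 1.
      apply/eqP; apply: (mulfI (prim_root_neq0 pr_l)).
      by rewrite mulr1 -exprS prednK ?expn_gt0 ?q0_gt0.
    move: l1; rewrite -(prim_order_dvd pr_l) => /dvdn_leq.
    have gt1 : (1 < q0 ^ (j %% k))%N by rewrite -{1}(exp1n (j %% k)) ltn_exp2r.
    rewrite -ltnS prednK ?(ltnW gt1) // => /(_ gt1).
    by rewrite qE -ltnS !prednK ?expn_gt0 ?q0_gt0 // leq_exp2l.
  rewrite kj /=; move: c0; rewrite -{1}(divnK kj) oddM.
  by move: eE; case: (neg eps0) => /=; case: (e); case: (odd k); rewrite ?andbF ?andbT //= => _ ->.
move=> fixl _; have lk : l ^+ (q0 ^ k) = l^-1 by rewrite -qE prim_root_Minus.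
have l2k : l ^+ (q0 ^ (2 * k)) = l by rewrite mul2n -addnn expnD exprM lk exprVn lk invrK.
have l2j : l ^+ (q0 ^ (2 * j)) = l.
  move: fixl; rewrite /fix_sg mul2n -addnn expnD exprM.
  case: (neg eps0 && _) => /= [|lj]; last by rewrite !lj.
  rewrite exprVn => /(congr1 GRing.inv).
  by rewrite invrK => lj; rewrite lj exprVn lj invrK.
have l0 := prim_root_neq0 pr_l.
have lr : l ^+ (q0 ^ ((2 * j) %% (2 * k))) = l.
  rewrite -[RHS]l2j [in RHS](divn_eq (2 * j) (2 * k)) expnD exprM.
  by rewrite [(_ * (2 * k))%N]mulnC expr_q_iterM.
have small r : (r < k)%N -> (r == 0)%N || (l ^+ (q0 ^ r) != l).
  move=> lt_rk; case: posnP => //= r_gt0; apply/eqP=> lr'.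
  have gt1 : (1 < q0 ^ r)%N by rewrite -{1}(exp1n r) ltn_exp2r.
  have l1 : l ^+ (q0 ^ r).-1 == 1.
    apply/eqP; apply: (mulfI l0).
    by rewrite mulr1 -exprS prednK // ltnW.
  move: l1; rewrite -(prim_order_dvd pr_l) => /dvdn_leq.
  rewrite -ltnS prednK ?(ltnW gt1) // => /(_ gt1).
  rewrite qE leqNgt ltnS => /negP[]; apply: (leq_trans (leq_pred _)).
  by rewrite leq_exp2l // ltnW.
have dvd2 : (2 * k %| 2 * j)%N.
  rewrite /dvdn; set r := (_ %% _)%N in lr *.
  have lt_r : (r < 2 * k)%N by rewrite ltn_pmod // muln_gt0.
  case: (ltnP r k) => [/small|le_kr]; first by rewrite lr eqxx orbF.
  (* Here l^(q0^k) = l^-1, so a remainder in [k, 2k) would make q + 1 divide q0^r' + 1, which is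
     smaller because r' < k. *)
  have [r' rE] : exists r', r = (k + r')%N by exists (r - k)%N; rewrite subnKC.
  have lt_r' : (r' < k)%N by move: lt_r; rewrite rE mul2n -addnn ltn_add2l.
  move: lr; rewrite rE expnD exprM lk exprVn => /(congr1 ( *%R (l ^+ (q0 ^ r')))).
  rewrite mulfV ?expf_neq0 // -exprSr => /esym/eqP; rewrite -(prim_order_dvd pr_l).
  by rewrite qE gtnNdvd // ltnS ltn_exp2l.
have kj : (k %| j)%N by rewrite dvdn_pmul2l in dvd2.
rewrite kj /=; move: fixl; have lq := prim_root_Minus pr_l.
have -> : (q0 ^ j = q ^ (j %/ k))%N by rewrite qE -expnM mulnC divnK.
rewrite (fix_sg_inv _ _ lq) -{1}(divnK kj) oddM.
have := prim_root_neqV pr_l; rewrite eq_sym; move: eE.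
by case: (neg eps0); case: (odd k); case: (e); case: (odd (j %/ k)) => //= _ /eqP.
Qed.

Lemma fix_sg_parity (l : F) j :
  (q_sub_eps eps0 q0).-primitive_root l ->
  fix_sg (neg eps && odd j) (q ^ j) l = l ->
  (eps0 = Plus -> neg eps && odd j = false) ->
  ~~ (e && odd j).
Proof.
case: eps0 epsE => /= -> pr_l; first by move=> _ /(_ erefl) ->.
rewrite qE -expnM (fix_sg_inv _ _ (prim_root_Minus pr_l)) oddM.
have := prim_root_neqV pr_l; rewrite eq_sym.
by case: (odd k); case: (e); case: (odd j) => //= /eqP.
Qed.

End Arithmetic.

(** * Automorphisms of PSL induced by matrix maps *)

Section Actions.

Variables (F : closedFieldType) (n : nat) (eps : sign) (q : char_power F).
Hypothesis n_ge3 : (3 <= n)%N.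
Variable l : F.
Hypothesis hl : (q_sub_eps eps q).-primitive_root%R l.

Local Notation GL := (GL n eps q).
Local Notation SL := (SL n eps q).
Local Notation PSL := (PSL n eps q).
Implicit Types (f : {perm coset_of 'Z(SL)}) (phi : 'M[F]_n -> 'M[F]_n) (u g : GL).

Lemma det_GL1 : (\det (val (1%g : GL)) = 1)%R.
Proof. exact: det1. Qed.

(** A relation, because [phi] lives on all matrices and only its values on SL count. It determines
    [f] ([acts_inj]), so identities between automorphisms of PSL reduce to matrix identities. *)
Definition acts f phi := f \in Aut PSL /\
  forall g, g \in SL -> exists g',
    [/\ g' \in SL, val g' = phi (val g) & f (coset 'Z(SL) g) = coset 'Z(SL) g'].

Lemma SL_det g : (g \in SL) = (\det (val g) == 1)%R.
Proof. by rewrite inE. Qed.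

Lemma acts_mul f f' phi phi' : acts f phi -> acts f' phi' ->
  acts (f * f') (phi' \o phi).
Proof.
move=> [Af fE] [Af' fE']; split=> [|g Sg]; first exact: groupM.
have [g' [Sg' g'E fg]] := fE g Sg; have [h [Sh hE fh]] := fE' g' Sg'.
by exists h; rewrite /= -g'E permM fg.
Qed.

Lemma acts_id : acts 1 id.
Proof. by split=> [|g Sg]; [exact: group1 | exists g; rewrite perm1]. Qed.

Lemma acts_iter f phi j : acts f phi -> acts (f ^+ j) (iter j phi).
Proof.
move=> fE; elim: j => [|j IH]; first exact: acts_id.
by rewrite expgSr; apply: acts_mul.
Qed.

Lemma acts_ext f phi phi' :
  (forall s, \det s = 1 -> sigma_mx eps q s = s -> phi s = phi' s)%R ->
  acts f phi -> acts f phi'.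
Proof.
move=> eq_phi [Af fE]; split=> // g Sg; have [g' [Sg' g'E fg]] := fE g Sg.
exists g'; rewrite -eq_phi ?GL_fix //; apply/eqP; by rewrite -SL_det.
Qed.

Lemma acts_inj f f' phi : acts f phi -> acts f' phi -> f = f'.
Proof.
move=> [Af fE] [Af' fE']; apply: (eq_Aut Af Af') => _ /morphimP[g _ Sg ->].
have [g' [_ g'E ->]] := fE g Sg; have [h [_ hE ->]] := fE' g Sg.
by congr coset; apply: val_inj; rewrite g'E hE.
Qed.

Lemma in_SL (s : 'M[F]_n) : (\det s = 1 -> sigma_mx eps q s = s ->
  exists2 g : GL, g \in SL & val g = s)%R.
Proof.
move=> ds qs; have sG : in_GL eps q s by rewrite /in_GL qs eqxx (det1_unit ds).
by exists (Sub s sG); rewrite ?SL_det //= ds.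
Qed.

(** Commuting with SL is the hypothesis of [fidelity] for the trivial field-graph map, with every
    scalar equal to 1. *)
Lemma center_SL_scalar g : g \in 'Z(SL) -> is_scalar_mx (val g).
Proof.
move=> /setIP[_ /centP cg];
have sgE s : sg false 1 s = s :> 'M[F]_n by apply/matrixP=> i j; rewrite mxE expr1.
have [] // := @fidelity F n n_ge3 eps q l false 1%N (val g) hl _ (Defs.GL_unit g).
move=> s ds qs; have [h Sh <-] := in_SL ds qs; exists 1%R.
by rewrite sgE scale1r -!val_GLM cg.
Qed.

Lemma acts_trivial f phi : acts f phi -> f = 1 <-> acts_trivially eps q phi.
Proof.
move=> [Af fE]; split=> [f1 s ds qs | triv].
  have [g Sg <-] := in_SL ds qs; have [g' [Sg' g'E fg]] := fE g Sg.
  rewrite f1 perm1 in fg.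
  have /rcosetP[z Zz g'z] : g' \in 'Z(SL) :* g.
    by apply/rcoset_kercosetP => //; exact: subsetP (gFnorm _ _) _ _.
  have /is_scalar_mxP[c cE] := center_SL_scalar Zz.
  by exists c; rewrite -g'E g'z val_GLM cE mul_scalar_mx.
apply: (eq_Aut Af (group1 _)) => _ /morphimP[g Ng Sg ->].
have [g' [Sg' g'E ->]] := fE g Sg; rewrite perm1.
apply/rcoset_kercosetP => //; first exact: subsetP (gFnorm _ _) _ Sg'.
apply/rcosetP; exists (g' * g^-1); last by rewrite mulgKV.
have [z zE] : exists z, phi (val g) = (z *: val g)%R.
  by apply: triv; rewrite ?GL_fix //; apply/eqP; rewrite -SL_det.
have zz : val (g' * g^-1) = z%:M%R.
  by rewrite val_GLM g'E zE -scalemxAl -val_GLM mulgV /= scalemx1.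
apply/setIP; split; first by rewrite groupM ?groupV.
apply/centP=> h _; apply: val_inj.
by rewrite /= -/(val _) [LHS](congr1 (fun A => A *m val h)%R zz) [RHS](congr1 (fun A => val h *m A)%R zz) scalar_mxC.
Qed.

Definition inner u := induced SL (actperm 'J u).

Definition conj_mx (a s : 'M[F]_n) : 'M_n := (invmx a *m s *m a)%R.

Lemma acts_inner u : acts (inner u) (conj_mx (val u)).
Proof.
have aM : {morph actperm 'J u : x y / x * y} by move=> g h; rewrite !actpermE /= conjMg.
have aS : {in SL, forall g, actperm 'J u g \in SL}.
  move=> g; rewrite actpermE /= !SL_det conjgE !val_GLM !det_mulmx mulrCA.
  by rewrite -(det_mulmx (val u^-1)) -val_GLM mulVg det_GL1 mulr1.
split=> [|g Sg]; first exact: Aut_induced.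
exists (actperm 'J u g); split; [exact: aS | | exact: inducedE].
by rewrite actpermE /= /conj_mx mulmxA.
Qed.

Lemma innerM u v : inner (u * v) = inner u * inner v.
Proof.
apply: acts_inj (acts_inner _) (acts_ext _ (acts_mul (acts_inner u) (acts_inner v))).
move=> s _ _; rewrite /conj_mx /= invmxM ?Defs.GL_unit //.
by rewrite -[val v]/(val v) !mulmxA.
Qed.

Lemma inner1 : inner 1 = 1.
Proof. by apply: (mulgI (inner 1)); rewrite -innerM !mulg1. Qed.

Lemma innerX u j : inner (u ^+ j) = inner u ^+ j.
Proof. by elim: j => [|j IH]; rewrite ?inner1 // !expgS innerM IH. Qed.

Lemma innerV u : inner u^-1 = (inner u)^-1.
Proof. by apply: (mulgI (inner u)); rewrite -innerM !mulgV inner1. Qed.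

Lemma mem_Inn f : reflect (exists2 s, s \in SL & f = inner s) (f \in Inn PSL).
Proof.
have innE s : s \in SL -> conj_aut PSL (coset 'Z(SL) s) = inner s.
  move=> Ss; have Ps : coset 'Z(SL) s \in PSL by exact: mem_quotient.
  apply: (@acts_inj _ _ (conj_mx (val s))); last exact: acts_inner.
  split; first exact: (subsetP (Aut_conj_aut _ _)) (mem_morphim _ (subsetP (normG _) _ Ps) Ps).
  move=> g Sg; exists (g ^ s); rewrite groupJ // norm_conj_autE ?mem_quotient //.
    rewrite morphJ ?(subsetP (gFnorm _ _)) //; split=> //.
    by rewrite /= /conj_mx mulmxA.
  exact: (subsetP (normG _)).
apply: (iffP morphimP) => [[_ _ /morphimP[s _ Ss ->] ->] | [s Ss ->]].
  by exists s => //; apply: innE.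
have Ps : coset 'Z(SL) s \in PSL by exact: mem_quotient.
by exists (coset 'Z(SL) s) => //; [exact: (subsetP (normG _)) | exact: esym (innE s Ss)].
Qed.

Lemma inner_expgz u i : expgz (inner u) i = inner (expgz u i).
Proof. by case: i => j; rewrite /= ?innerV innerX. Qed.

Lemma det_dil_mx (x : F) : (\det (dil_mx n x) = x)%R.
Proof.
case: n n_ge3 => // n' _; rewrite det_diag big_ord_recl mxE /= big1 ?mulr1 //.
by move=> i _; rewrite mxE.
Qed.

Lemma det_expgz_delta i : (\det (val (expgz (delta_GL n hl) i)) = l ^ i)%R.
Proof.
have detX j : (\det (val (delta_GL n hl ^+ j)%g) = l ^+ j)%R.
  elim: j => [|j IH]; first by rewrite /= det1.
  by rewrite expgS val_GLM det_mulmx IH exprS; congr (_ * _)%R; exact: det_dil_mx.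
by case: i => j /=; rewrite ?det_inv detX.
Qed.

(** Multiplication by SL leaves the determinant alone, so the coset of the i-th power of delta
    consists of the inner-diagonal automorphisms of determinant l^i. From here on, cosets are
    handled through determinants only. *)
Lemma mem_omega_coset f i a :
  reflect (exists2 u, (\det (val u) = l ^ i)%R & a = #[f * inner u])
          (a \in omega (f * expgz (delta n hl) i *: Inn PSL)).
Proof.
rewrite /omega (inner_expgz (delta_GL n hl)); set d := expgz _ i.
apply: (iffP imageP) => [[x /lcosetP[y /mem_Inn[s Ss ->] ->] ->] | [u du ->]].
  exists (d * s); last by rewrite innerM mulgA.
  by rewrite val_GLM det_mulmx det_expgz_delta; move: Ss; rewrite SL_det => /eqP->; rewrite mulr1.
exists (f * inner u) => //; apply/lcosetP; exists (inner (d^-1 * u)).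
  apply/mem_Inn; exists (d^-1 * u) => //.
  rewrite SL_det val_GLM det_mulmx [val _]/= det_inv du det_expgz_delta mulVf //.
  by rewrite expfz_neq0 // (prim_root_neq0 hl).
by rewrite -mulgA -innerM mulKVg.
Qed.

End Actions.

(** * Shintani descent *)

Section Shintani.

Local Open Scope ring_scope.

Variables (F : closedFieldType) (n : nat) (q q0 : char_power F) (k : nat).
Variables (eps eps0 : sign) (e : bool) (l l0 : F).
Hypotheses (n_ge3 : (3 <= n)%N) (k_gt0 : (0 < k)%N) (qE : q = (q0 ^ k)%N :> nat).
Hypothesis epsE : neg eps = (neg eps0 && odd k) (+) e.
Hypotheses (hl : (q_sub_eps eps q).-primitive_root l)
  (hl0 : (q_sub_eps eps0 q0).-primitive_root l0).

Implicit Types (A a : 'M[F]_n).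

Lemma iter_sigma_mx_eq A j : (k %| j)%N -> ~~ (e && odd (j %/ k)) ->
  iter j (sigma_mx eps0 q0) A = iter (j %/ k) (sigma_mx eps q) A.
Proof.
move=> kj ej; rewrite !iter_sigma_mx qE -expnM [(k * _)%N]mulnC divnK //.
congr sg; rewrite epsE -{1}(divnK kj) oddM; move: ej.
by case: (neg eps0); case: (odd k); case: (e); case: (odd (j %/ k)).
Qed.

Lemma iter_sigma_mx_fix eps' (q' : char_power F) A j : sigma_mx eps' q' A = A ->
  iter j (sigma_mx eps' q') A = A.
Proof. by move=> fixA; elim: j => //= j ->. Qed.

Lemma trivial_conj_sigma a j : a \in unitmx ->
  acts_trivially eps q (iter j (conj_sigma eps0 q0 a)) <->
  (k %| j)%N && ~~ (e && odd (j %/ k)) /\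
    is_scalar_mx (invmx a *m iter (j %/ k) (sigma_mx eps q) a).
Proof.
move=> ua; split=> [triv | [/andP[kj ej] sc]].
  have [sc fixl signs] := acts_trivially_necessary n_ge3 ua hl triv.
  have kj := fix_sg_dvd k_gt0 qE epsE hl fixl signs; split=> //.
  by have /andP[kj1 kj2] := kj; rewrite -iter_sigma_mx_eq.
apply: acts_trivially_sufficient => // [|s qs]; rewrite iter_sigma_mx_eq //.
exact: iter_sigma_mx_fix.
Qed.

Lemma scalar_mx_conjV A B : A \in unitmx -> B \in unitmx ->
  is_scalar_mx (invmx A *m B) -> is_scalar_mx (A *m invmx B).
Proof.
move=> uA uB /is_scalar_mxP[c cE].
have BE : B = c *: A by rewrite -mul_mx_scalar -cE mulKVmx.
have c0 : c *: (A *m invmx B) = 1%:M by rewrite scalemxAl -BE mulmxV.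
have [c00 | cn0] := eqVneq c 0; last first.
  apply/is_scalar_mxP; exists c^-1.
  by rewrite -[LHS](scalerK cn0) c0 scalemx1.
by rewrite -[A *m _]mul1mx -c0 c00 scale0r mul0mx mx0_is_scalar.
Qed.

(** Conjugation by a^-1 leads to a F1^t(a)^-1, which is scalar exactly when a^-1 F1^t(a) is. The
    criterion thus matches that of [trivial_conj_sigma] with t = j / k. *)
Lemma trivial_conj_sigmaV a t : a \in unitmx ->
  acts_trivially eps0 q0 (iter t (conj_sigma eps q (invmx a))) <->
  ~~ (e && odd t) /\ is_scalar_mx (invmx a *m iter t (sigma_mx eps q) a).
Proof.
move=> ua; have uV : invmx a \in unitmx by rewrite unitmx_inv.
have uFa : iter t (sigma_mx eps q) a \in unitmx by rewrite iter_sigma_mx_unit.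
split=> [triv | [et sc]].
  have [sc fixl signs] := acts_trivially_necessary n_ge3 uV hl0 triv.
  split; first exact: (fix_sg_parity qE epsE hl0 fixl signs).
  move: sc; rewrite invmxK iter_sigma_mxV // => sc.
  rewrite -[X in is_scalar_mx (_ *m X)]invmxK; apply: scalar_mx_conjV; rewrite ?unitmx_inv //.
  by rewrite invmxK.
apply: acts_trivially_sufficient => // [|s qs].
  by rewrite iter_sigma_mxV // invmxK; apply: scalar_mx_conjV.
have <- : iter (k * t) (sigma_mx eps0 q0) s = iter t (sigma_mx eps q) s.
  by rewrite iter_sigma_mx_eq ?dvdn_mulr // mulKn.
exact: iter_sigma_mx_fix.
Qed.

Section Orders.

Variables (f : {perm coset_of 'Z(SL n eps q)%g}) (f0 : {perm coset_of 'Z(SL n eps0 q0)%g}).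
Hypotheses (fE : acts f (sigma_mx eps0 q0)) (f0E : acts f0 (sigma_mx eps q)).

Lemma shintani_order a (u : Defs.GL n eps q) (v : Defs.GL n eps0 q0) :
  a \in unitmx -> val u = invmx (sigma_mx eps0 q0 a) *m a ->
  val v = sigma_mx eps q a *m invmx a ->
  #[(f * inner u)%g]%g = (k * #[(f0 * inner v)%g]%g)%N.
Proof.
move=> ua uE vE.
have xE : acts (f * inner u)%g (conj_sigma eps0 q0 a).
  apply: acts_ext (acts_mul fE (acts_inner u)) => s ds _ /=.
  have us := det1_unit ds.
  rewrite /conj_mx /conj_sigma uE invmxM ?unitmx_inv ?sigma_mx_unit // invmxK.
  rewrite !sigma_mxM ?unitmx_mul ?unitmx_inv ?ua ?us // sigma_mxV //.
  by rewrite !mulmxA.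
have yE : acts (f0 * inner v)%g (conj_sigma eps q (invmx a)).
  apply: acts_ext (acts_mul f0E (acts_inner v)) => s ds _ /=.
  have us := det1_unit ds.
  rewrite /conj_mx /conj_sigma vE invmxM ?unitmx_inv ?sigma_mx_unit // invmxK.
  rewrite !sigma_mxM ?unitmx_mul ?unitmx_inv ?ua ?us // sigma_mxV //.
  by rewrite !mulmxA.
(* Both criteria are phrased through the same matrix; this equivalence alone yields the two
   divisibilities between the orders. *)
have orderP j : ((f * inner u)%g ^+ j == 1)%g =
    (k %| j)%N && ((f0 * inner v)%g ^+ (j %/ k) == 1)%g.
  have xj := acts_trivial n_ge3 hl (acts_iter j xE).
  have yj := acts_trivial n_ge3 hl0 (acts_iter (j %/ k) yE).
  have xt := trivial_conj_sigma j ua; have yt := trivial_conj_sigmaV (j %/ k) ua.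
  apply/eqP/andP=> [/xj/xt[/andP[kj ej] sc] | [kj /eqP/yj/yt[ej sc]]].
    by split=> //; apply/eqP/yj/yt.
  by apply/xj/xt; rewrite kj ej.
apply/eqP; rewrite eqn_dvd order_dvdn orderP dvdn_mulr // mulKn // expg_order eqxx /=.
have := expg_order (f * inner u)%g => /eqP; rewrite orderP => /andP[kx].
rewrite -order_dvdn => oy; rewrite -(divnK kx) mulnC dvdn_pmul2r //.
Qed.

End Orders.

End Shintani.

(** * Determinants *)

Section Determinants.

Local Open Scope ring_scope.

Variable F : closedFieldType.
Implicit Types (q : char_power F) (eps : sign) (x y : F).

Lemma fix_sgM c r x y : fix_sg c r (x * y) = fix_sg c r x * fix_sg c r y.
Proof. by rewrite /fix_sg; case: c; rewrite ?invfM exprMn. Qed.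

Lemma fix_sgV c r x : fix_sg c r x^-1 = (fix_sg c r x)^-1.
Proof. by rewrite /fix_sg; case: c; rewrite ?exprVn ?invrK. Qed.

Lemma fix_sgX c r x j : fix_sg c r (x ^+ j) = fix_sg c r x ^+ j.
Proof. by rewrite /fix_sg; case: c; rewrite -?exprVn exprAC. Qed.

Lemma fix_sgXz c r x (i : int) : fix_sg c r (x ^ i) = fix_sg c r x ^ i.
Proof. by case: i => j; rewrite ?NegzE -?exprnN -?exprnP ?fix_sgV fix_sgX. Qed.

Lemma fix_sgC c r c' r' x : fix_sg c r (fix_sg c' r' x) = fix_sg c' r' (fix_sg c r x).
Proof. by rewrite /fix_sg; case: c; case: c'; rewrite ?exprVn ?invrK exprAC. Qed.

Lemma fix_sg_eq0 c r x : x != 0 -> fix_sg c r x != 0.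
Proof. by move=> x0; rewrite /fix_sg; case: c; rewrite expf_neq0 ?invr_eq0. Qed.

Lemma det_sigma_mx n eps q (A : 'M[F]_n) :
  \det (sigma_mx eps q A) = fix_sg (neg eps) q (\det A).
Proof.
rewrite /fix_sg; case: eps; rewrite /= /phi_mx det_map_mx; first by [].
by rewrite /tau_mx det_tr det_inv.
Qed.

Lemma div_fix_sg eps q x : x != 0 ->
  x / fix_sg (neg eps) q x =
    if neg eps then x ^+ q_sub_eps eps q else (x ^+ q_sub_eps eps q)^-1.
Proof.
move=> x0; case: eps => /=; rewrite /fix_sg ?exprVn ?invrK -?exprS //.
have q_gt0 := ltnW (cp_gt1 q).
by rewrite -{1}(prednK q_gt0) exprS invfM mulVKf.
Qed.

Lemma q_sub_eps_gt0 eps q : (0 < q_sub_eps eps q)%N.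
Proof. by case: eps => //=; rewrite -ltnS prednK ?(ltnW (cp_gt1 q)) ?cp_gt1. Qed.

Lemma fix_sg_unity eps q x : x != 0 ->
  (fix_sg (neg eps) q x == x) = (x ^+ q_sub_eps eps q == 1).
Proof.
move=> x0; have fx := fix_sg_eq0 (neg eps) q x0.
transitivity (x / fix_sg (neg eps) q x == 1).
  by rewrite -subr_eq0 -[RHS]subr_eq0 -[1 in RHS](divff fx) -mulrBl mulf_eq0 invr_eq0 (negPf fx) orbF -oppr_eq0 opprB.
rewrite div_fix_sg //; case: (neg eps) => //.
by rewrite invr_eq1.
Qed.

(** Lang's theorem for GL_1, which amounts to extracting a root of degree [q_sub_eps eps q]. *)
Lemma lang_scalar eps q x : x != 0 ->
  exists2 y, y != 0 & y / fix_sg (neg eps) q y = x.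
Proof.
move=> x0; have d_gt0 := q_sub_eps_gt0 eps q.
have [y yE] := nth_root_exists (if neg eps then x else x^-1) d_gt0.
have y0 : y != 0.
  apply: contraNneq x0 => y0; move: yE; rewrite y0 expr0n (gtn_eqF d_gt0) => /esym/eqP.
  by case: (neg eps); rewrite ?invr_eq0.
by exists y; rewrite ?div_fix_sg // yE; case: (neg eps); rewrite ?invrK.
Qed.

Lemma fix_sg_of_div c r x y : x != 0 -> x / fix_sg c r x = y -> fix_sg c r x = x / y.
Proof. by move=> x0 <-; rewrite invf_div mulrCA divff ?mulr1. Qed.

Lemma prim_root_fix eps q (l : F) : (q_sub_eps eps q).-primitive_root l ->
  fix_sg (neg eps) q l = l.
Proof.
move=> hl; apply/eqP; rewrite fix_sg_unity ?(prim_root_neq0 hl) //.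
by rewrite prim_expr_order.
Qed.

Section Transfer.

Variables (q q0 : char_power F) (k : nat) (eps eps0 : sign) (e : bool) (l l0 : F).
Hypotheses (k_gt0 : (0 < k)%N) (qE : q = (q0 ^ k)%N :> nat).
Hypothesis epsE : neg eps = (neg eps0 && odd k) (+) e.
Hypotheses (hl : (q_sub_eps eps q).-primitive_root l)
  (hl0 : (q_sub_eps eps0 q0).-primitive_root l0).

Lemma fix_sg_on_fixed x : fix_sg (neg eps0) q0 x = x ->
  fix_sg (neg eps) q x = if e then x^-1 else x.
Proof.
rewrite qE epsE; case: eps0 => /= xq.
  have xk : x ^+ (q0 ^ k) = x.
    by rewrite -[k]mul1n expr_q_iterM // expn1.
  by rewrite /fix_sg; case: (e); rewrite /= ?exprVn xk.
have xV : x ^+ q0 = x^-1 by rewrite -{2}xq /fix_sg exprVn invrK.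
by rewrite fix_sg_inv //; case: (odd k); case: (e).
Qed.

Lemma sigma_on_fixed n (A : 'M[F]_n) : sigma_mx eps0 q0 A = A ->
  sigma_mx eps q A = if e then tau_mx A else A.
Proof.
move=> fixA; have iterA B : sigma_mx eps0 q0 B = B ->
    sg (neg eps0 && odd k) (q0 ^ k) B = B.
  by move=> fixB; rewrite -iter_sigma_mx iter_sigma_mx_fix.
have -> : sigma_mx eps q A = sg (neg eps) (q0 ^ k) A by rewrite -qE; case: (eps).
rewrite epsE; case: (e); last by rewrite addbF iterA.
rewrite -[RHS]iterA ?tau_sigma_mx ?fixA // /sg addbT.
by case: (neg eps0 && odd k); rewrite //= tau_mxK.
Qed.

(** F2 divides z by l^i, and F1 fixes l^i and commutes with F2, so the factor cancels in F1(z) /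
    z. *)
Lemma twisted_det_fixed (i : int) z : z != 0 -> z / fix_sg (neg eps0) q0 z = l ^ i ->
  fix_sg (neg eps0) q0 (fix_sg (neg eps) q z / z) = fix_sg (neg eps) q z / z.
Proof.
move=> z0 zE; have fz := fix_sg_of_div z0 zE.
have li0 : l ^ i != 0 by rewrite expfz_neq0 // (prim_root_neq0 hl).
rewrite fix_sgM fix_sgV fix_sgC fz fix_sgM fix_sgV fix_sgXz (prim_root_fix hl).
by rewrite invfM invrK mulrACA mulVf ?mulr1.
Qed.

(** Let m be the order of mu, and let d and Q be the orders of l0 and l; then Q = N d, as F1 fixes
    l0. Since mu^m = 1, F1 fixes z^m, so z^m is a power l^t. Then l^m = l^t / F2(l^t) is, up to
    inversion, l^(t d), and its N-th power is 1. So Q divides m N, and d divides m. *)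
Lemma twisted_root_prim z : e = false -> z != 0 -> z / fix_sg (neg eps0) q0 z = l ->
  (q_sub_eps eps0 q0).-primitive_root (fix_sg (neg eps) q z / z).
Proof.
move=> e0 z0 zE; set mu := _ / z; set d := q_sub_eps eps0 q0.
have d_gt0 : (0 < d)%N by exact: q_sub_eps_gt0.
have mu0 : mu != 0 by rewrite mulf_neq0 ?invr_eq0 ?fix_sg_eq0.
have mud : mu ^+ d = 1.
  apply/eqP; rewrite -fix_sg_unity // /mu (@twisted_det_fixed 1) //.
have [m pr_m dvd_md] := prim_order_exists d_gt0 mud.
suff dvd_dm : (d %| m)%N by have /eqP <- : m == d; rewrite // eqn_dvd dvd_md.
have zm0 : z ^+ m != 0 by rewrite expf_neq0.
have : fix_sg (neg eps) q (z ^+ m) == z ^+ m.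
  have := prim_expr_order pr_m; rewrite /mu exprMn exprVn -fix_sgX.
  by move=> /(canRL (mulfVK zm0)); rewrite mul1r => ->.
rewrite fix_sg_unity // => /eqP/(prim_rootP hl)[t zmE].
have l0Q : l0 ^+ q_sub_eps eps q = 1.
  apply/eqP; rewrite -fix_sg_unity ?(prim_root_neq0 hl0) //.
  by rewrite fix_sg_on_fixed ?e0 // (prim_root_fix hl0).
have /dvdnP[N QE] : (d %| q_sub_eps eps q)%N by rewrite (prim_order_dvd hl0) l0Q.
have lmE : l ^+ m = l ^+ t / fix_sg (neg eps0) q0 (l ^+ t).
  by rewrite -zmE fix_sgX -exprVn -exprMn zE.
have : (l ^+ m) ^+ N == 1.
  rewrite lmE div_fix_sg ?expf_neq0 ?(prim_root_neq0 hl) // -/d.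
  have ltd : l ^+ t ^+ d ^+ N = 1.
    by rewrite -!exprM [(d * N)%N]mulnC -QE mulnC exprM (prim_expr_order hl) expr1n.
  by case: (neg eps0); rewrite ?exprVn ltd ?invr1.
rewrite -exprM -(prim_order_dvd hl) QE mulnC dvdn_pmul2r //.
by move: (q_sub_eps_gt0 eps q); rewrite QE; case: (N).
Qed.

(** If z solves the equation for i = 1, then y / z^i is fixed by F2, hence by F1 since [e] is false.
    So y contributes the i-th power of what z contributes. *)
Lemma twisted_det_power (i : int) y : e = false -> y != 0 ->
  y / fix_sg (neg eps0) q0 y = l ^ i ->
  exists2 mu, (q_sub_eps eps0 q0).-primitive_root mu & fix_sg (neg eps) q y / y = mu ^ i.
Proof.
move=> e0 y0 yE; have [z z0 zE] := lang_scalar eps0 q0 (prim_root_neq0 hl).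
exists (fix_sg (neg eps) q z / z); first exact: twisted_root_prim.
have zi0 : z ^ i != 0 by rewrite expfz_neq0.
have li0 : l ^ i != 0 by rewrite expfz_neq0 // (prim_root_neq0 hl).
have yz : fix_sg (neg eps) q (y / z ^ i) = y / z ^ i.
  rewrite fix_sg_on_fixed ?e0 // fix_sgM fix_sgV fix_sgXz.
  rewrite (fix_sg_of_div y0 yE) (fix_sg_of_div z0 zE) expfzMl -expfV.
  by rewrite invfM invrK mulrACA mulVf ?mulr1.
have yE' : y = z ^ i * (y / z ^ i) by rewrite mulrCA divff ?mulr1.
rewrite [in fix_sg _ _ y]yE' fix_sgM yz fix_sgXz expfzMl -expfV.
by rewrite -mulrA [y / _ / y]mulrAC divff // mul1r.
Qed.

Lemma prim_root_half d (x : F) h : d.-primitive_root x -> d = (2 * h)%N -> x ^+ h = -1.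
Proof.
move=> pr_x dE; have : (x ^+ h) ^+ 2 == 1.
  by rewrite -exprM mulnC -dE prim_expr_order.
rewrite sqrf_eq1 => /orP[|/eqP//]; rewrite -(prim_order_dvd pr_x).
have := prim_order_gt0 pr_x; rewrite dE; case: h {dE} => // h _.
by rewrite gtnNdvd // -{1}[h.+1]mul1n ltn_pmul2r.
Qed.

(** In odd characteristic, with d = 2h the order of l0, both rho and l0^i have h-th power (-1)^i, so
    their quotient is a square among the d-th roots of unity. In characteristic 2 the sign ambiguity
    of the root disappears. *)
Lemma twisted_det_square (i : int) y : y != 0 ->
  y / fix_sg (neg eps0) q0 y = l ^ i ->
  exists eta, [/\ eta != 0, fix_sg (neg eps0) q0 eta = eta
    & fix_sg (neg eps) q y / y = l0 ^ i * eta ^+ 2].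
Proof.
move=> y0 yE; set rho := _ / y.
have rho0 : rho != 0 by rewrite mulf_neq0 ?invr_eq0 ?fix_sg_eq0.
have rho_fix : fix_sg (neg eps0) q0 rho = rho by exact: twisted_det_fixed yE.
have l0i : l0 ^ i != 0 by rewrite expfz_neq0 // (prim_root_neq0 hl0).
have [eta etaE] := nth_root_exists (rho / l0 ^ i) (isT : (0 < 2)%N).
have eta0 : eta != 0.
  have : rho / l0 ^ i != 0 by rewrite mulf_neq0 ?invr_eq0.
  by rewrite -etaE expf_eq0.
exists eta; split=> //; last by rewrite etaE mulrCA divff ?mulr1.
set d := q_sub_eps eps0 q0.
have eta_sq : (eta ^+ d) ^+ 2 = 1.
  rewrite exprAC etaE exprMn exprVn.
  have /eqP := rho_fix; rewrite fix_sg_unity // => /eqP->.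
  have : fix_sg (neg eps0) q0 (l0 ^ i) == l0 ^ i by rewrite fix_sgXz (prim_root_fix hl0).
  by rewrite fix_sg_unity // => /eqP->; rewrite divff ?oner_neq0.
apply/eqP; rewrite fix_sg_unity // -/d.
have /orP[//|/eqP etad] : (eta ^+ d == 1) || (eta ^+ d == -1) by rewrite -sqrf_eq1 eta_sq.
case odd_q0 : (odd q0); last first.
  have ch2 : 2 \in [pchar F].
    have /andP[q0_gt0 /allP q0F] := cp_pnat q0.
    by apply: q0F; rewrite mem_primes q0_gt0 /= dvdn2 odd_q0.
  by rewrite etad oppr_pchar2.
have [h dE] : exists h, d = (2 * h)%N.
  exists d./2; rewrite mul2n even_halfK // /d.
  by case: (eps0); rewrite /= ?odd_q0 // -subn1 oddB ?odd_q0 // (ltnW (cp_gt1 q0)).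
have [H QE] : exists H, q_sub_eps eps q = (2 * H)%N.
  have odd_q : odd q by rewrite qE oddX odd_q0 orbT.
  exists (q_sub_eps eps q)./2; rewrite mul2n even_halfK //.
  by case: (eps); rewrite /= ?odd_q // -subn1 oddB ?odd_q // (ltnW (cp_gt1 q)).
have sgnV : ((-1) ^ i)^-1 = (-1) ^ i :> F by rewrite expfV invrN1.
suff : rho ^+ h = (-1) ^ i.
  move=> rhoh; rewrite dE exprM etaE exprMn rhoh exprVn.
  rewrite -[_ ^+ h]/(_ ^ h%:Z) exprzAC -[l0 ^ h]/(l0 ^+ h) (prim_root_half hl0 dE).
  by rewrite divff // expfz_neq0 // oppr_eq0 oner_neq0.
have yd : (y ^+ d) ^+ H = (-1) ^ i.
  have lH : (l ^ i) ^+ H = (-1) ^ i.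
    by rewrite -[_ ^+ H]/(_ ^ H%:Z) exprzAC -[l ^ H]/(l ^+ H) (prim_root_half hl QE).
  move: lH; rewrite -yE div_fix_sg // -/d; case: (neg eps0) => //.
  by rewrite exprVn => /(congr1 GRing.inv); rewrite invrK sgnV.
have rhoE : rho = if neg eps then (y ^+ q_sub_eps eps q)^-1 else y ^+ q_sub_eps eps q.
  by rewrite /rho -invf_div div_fix_sg //; case: (neg eps); rewrite ?invrK.
have yQh : (y ^+ q_sub_eps eps q) ^+ h = (-1) ^ i.
  by rewrite -yd QE dE -!exprM; congr (y ^+ _); rewrite mulnAC.
by rewrite rhoE; case: (neg eps); rewrite ?exprVn yQh.
Qed.

End Transfer.

End Determinants.

(** Lifts a unit modulo d to a number prime to o. With c the part of o prime to j, a prime divisor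
    of o divides exactly one of j and d c or misses their sum for the same reason: those dividing j
    divide neither d nor c, the others divide c but not j. *)
Lemma coprime_shift (o d j : nat) : (0 < o)%N -> (0 < j)%N -> coprime j d ->
  exists c, coprime o (j + d * c).
Proof.
move=> o_gt0 j_gt0 co_jd; pose c := (o`_(\pi(j)^'))%N; exists c.
apply: contraT => /eqP; set g := gcdn _ _ => g1.
have r_pr : prime (pdiv g).
  rewrite pdiv_prime // ltn_neqAle eq_sym gcdn_gt0 o_gt0 andbT; exact/eqP.
have := pdiv_dvd g; rewrite {2}/g dvdn_gcd; set r := pdiv g in r_pr * => /andP[ro rs].
case rj: (r %| j).
  move: rs; rewrite dvdn_addr // Euclid_dvdM // => /orP[rd | rc].
    have : r %| gcdn j d by rewrite dvdn_gcd rj.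
    by rewrite (eqP co_jd) dvdn1 => /eqP r1; rewrite r1 in r_pr.
  have := pnat_dvd rc (part_pnat _ _); rewrite pnatE //.
  by rewrite !inE /= mem_primes r_pr j_gt0 rj.
have rc : r %| c.
  rewrite -(@part_pnat_id (\pi(j)^') r) ?partn_dvd //.
  by rewrite pnatE // !inE /= mem_primes r_pr j_gt0 rj.
by rewrite dvdn_addl ?rj ?dvdn_mull in rs.
Qed.

(** * Adjusting determinants without changing orders *)

Section Transfer.

Variables (F : closedFieldType) (n : nat) (eps : sign) (q : char_power F) (l : F).
Hypotheses (n_ge3 : (3 <= n)%N) (hl : (q_sub_eps eps q).-primitive_root%R l).

Local Notation GL := (Defs.GL n eps q).

Lemma dil_GL (x : F) : x != 0%R -> fix_sg (neg eps) q x = x ->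
  exists w : GL, val w = dil_mx n x.
Proof.
move=> x0 xq; have wG : in_GL eps q (dil_mx n x).
  rewrite /in_GL dil_mx_unit //=; move: xq; rewrite /fix_sg.
  by case: (eps) => /= xq; rewrite ?tau_dil_mx // phi_dil_mx xq.
by exists (Sub (dil_mx n x) wG).
Qed.

(* For t prime to the order of x, the power x^t has the same order as x and lies
   in the coset obtained by changing the primitive root. *)
Lemma order_inner_prim_root (mu nu : F) (i : int) (v : GL) :
  (q_sub_eps eps q).-primitive_root%R mu -> (q_sub_eps eps q).-primitive_root%R nu ->
  (\det (val v) = mu ^ i)%R ->
  exists2 v' : GL, (\det (val v') = nu ^ i)%R & #[inner v'] = #[inner v].
Proof.
set d := q_sub_eps eps q => pr_mu pr_nu dv.
have [[j lt_j] /= nuE] := prim_rootP pr_mu (prim_expr_order pr_nu).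
have co_jd : coprime j d.
  by move: pr_nu; rewrite nuE prim_root_exp_coprime.
(* The exponent [j] may be 0 when d = 1, whereas [coprime_shift] wants a positive number. *)
have co_jdd : coprime (j + d) d by rewrite coprime_sym /coprime gcdnDr -/(coprime d j) coprime_sym.
have [|c co_o] := coprime_shift (order_gt0 (inner v)) _ co_jdd.
  by rewrite addn_gt0 (prim_order_gt0 pr_mu) orbT.
exists (v ^+ (j + d + d * c)); last first.
  by rewrite innerX // orderXgcd (eqP co_o) divn1.
have detX t : (\det (val (v ^+ t)%g) = (mu ^ i) ^+ t)%R.
  elim: t => [|t IH]; first by rewrite det_GL1.
  by rewrite expgS val_GLM det_mulmx IH dv -exprS.
rewrite detX -[LHS]/((mu ^ i) ^ (j + d + d * c)%:Z)%R exprzAC; congr (_ ^ _)%R.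
rewrite -[LHS]/(mu ^+ (j + d + d * c))%R !exprD exprM (prim_expr_order pr_mu) expr1n.
by rewrite !mulr1.
Qed.

(** Conjugate by [inner w] with w = diag(y, 1, ..., 1): moving w^-1 across [f] turns it into
    tau(w)^-1, again of determinant y, so the determinant of [v] gains y twice. *)
Lemma order_inner_square f (x y : F) (v : GL) :
  acts f (@tau_mx F n) -> y != 0%R -> fix_sg (neg eps) q y = y ->
  (\det (val v) = x)%R ->
  exists2 v' : GL, (\det (val v') = x * y ^+ 2)%R & #[f * inner v'] = #[f * inner v].
Proof.
move=> fE y0 yq dv; have [w wE] := dil_GL y0 yq.
have wV : f * inner (tau_GL w)^-1 = inner w^-1 * f.
  apply: acts_inj (acts_mul fE (acts_inner _)) _.
  apply: acts_ext (acts_mul (acts_inner _) fE) => s ds qs /=.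
  have us := det1_unit ds.
  rewrite /conj_mx /= !invmxK !tau_mxM ?unitmx_mul ?unitmx_inv ?us ?Defs.GL_unit //.
  by congr (_ *m _)%R; rewrite /tau_mx -trmx_inv.
exists ((tau_GL w)^-1 * v * w).
  rewrite !val_GLM !det_mulmx dv /= det_inv /tau_mx det_tr det_inv invrK wE det_dil_mx //.
  by rewrite expr2 mulrA [(y * x)%R]mulrC.
by rewrite -(orderJ (f * inner v) (inner w)) conjgE !innerM // !mulgA wV innerV.
Qed.

End Transfer.

Section DescentMatrix.

Local Open Scope ring_scope.

Variables (F : closedFieldType) (n : nat) (q q' : char_power F) (eps eps' : sign).

Lemma sigma_mxC (A : 'M[F]_n) :
  sigma_mx eps q (sigma_mx eps' q' A) = sigma_mx eps' q' (sigma_mx eps q A).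
Proof. by case: eps' => /=; rewrite phi_sigma_mx ?tau_sigma_mx. Qed.

Lemma descent_in_GL (a w : 'M[F]_n) : a \in unitmx -> w \in unitmx ->
  sigma_mx eps' q' a = a *m w -> sigma_mx eps q w = w ->
  in_GL eps' q' (sigma_mx eps q a *m invmx a).
Proof.
move=> ua uw aE wq; rewrite /in_GL unitmx_mul sigma_mx_unit unitmx_inv ua /=.
rewrite sigma_mxM ?sigma_mx_unit ?unitmx_inv // sigma_mxV // -sigma_mxC aE.
by rewrite sigma_mxM // wq invmxM // mulmxA mulmxK.
Qed.

End DescentMatrix.

(** * Descent of cosets *)

Section Main.

Variables (F : closedFieldType) (n : nat) (q q0 : char_power F) (k : nat).
Variables (eps eps0 : sign) (l l0 : F).
Hypotheses (n_ge3 : (3 <= n)%N) (k_gt0 : (0 < k)%N) (qE : q = (q0 ^ k)%N :> nat).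
Hypotheses (hl : (q_sub_eps eps q).-primitive_root%R l)
  (hl0 : (q_sub_eps eps0 q0).-primitive_root%R l0).
Hypothesis F_alg : forall x : F, exists2 N, (0 < N)%N & (x ^+ (q ^ N) = x)%R.
Hypothesis F_alg0 : forall x : F, exists2 N, (0 < N)%N & (x ^+ (q0 ^ N) = x)%R.
Variables (f : {perm coset_of 'Z(SL n eps q)}) (f0 : {perm coset_of 'Z(SL n eps0 q0)}).
Hypotheses (fE : acts f (sigma_mx eps0 q0)) (f0E : acts f0 (sigma_mx eps q)).

Let e := neg eps (+) (neg eps0 && odd k).

Let epsE : neg eps = (neg eps0 && odd k) (+) e.
Proof. by rewrite /e addbC addbK. Qed.

(** The flag [b] picks the direction: [true] normalises a determinant produced by descent to l0^i,
    [false] prepares an element of determinant l0^i for lifting. *)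
Lemma order_transfer (i : int) (y : F) (v : Defs.GL n eps0 q0) (b : bool) :
  y != 0%R -> (y / fix_sg (neg eps0) q0 y = l ^ i)%R ->
  let r := (fix_sg (neg eps) q y / y)%R in
  (\det (val v) = if b then r else l0 ^ i)%R ->
  exists2 v' : Defs.GL n eps0 q0, (\det (val v') = if b then l0 ^ i else r)%R
    & #[f0 * inner v'] = #[f0 * inner v].
Proof.
move=> y0 yE r dv; case e_eq: e epsE => epsE'.
  have f0_tau : acts f0 (@tau_mx F n).
    apply: acts_ext f0E => s _ qs.
    by rewrite (sigma_on_fixed qE epsE' qs).
  have [x [x0 xq rE]] := twisted_det_square qE hl hl0 y0 yE.
  case: b dv => dv.
    have [||v' dv' ov'] := order_inner_square n_ge3 f0_tau (_ : x^-1 != 0)%R _ dv.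
    - by rewrite invr_eq0.
    - by rewrite fix_sgV xq.
    by exists v' => //; rewrite dv' /r rE exprVn mulfK ?expf_neq0.
  have [v' dv' ov'] := order_inner_square n_ge3 f0_tau x0 xq dv.
  by exists v' => //; rewrite dv' /r rE.
have f0_1 : f0 = 1.
  apply: (acts_inj f0E); apply: acts_ext (@acts_id F n eps0 q0) => s _ qs.
  by rewrite (sigma_on_fixed qE epsE' qs).
have [mu pr_mu rE] := twisted_det_power qE epsE' hl hl0 erefl y0 yE.
rewrite f0_1; case: b dv; rewrite /r rE => dv.
  have [v' dv' ov'] := order_inner_prim_root pr_mu hl0 dv.
  by exists v'; rewrite ?mul1g.
have [v' dv' ov'] := order_inner_prim_root hl0 pr_mu dv.
by exists v'; rewrite ?mul1g.
Qed.

Lemma omega_descent (i : int) :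
  omega (f * expgz (delta n hl) i *: Inn (PSL n eps q)) =i
    dilate k (omega (f0 * expgz (delta n hl0) i *: Inn (PSL n eps0 q0))).
Proof.
have li0 (i' : int) : (l ^ i' != 0)%R by rewrite expfz_neq0 // (prim_root_neq0 hl).
move=> o; apply/(mem_omega_coset n_ge3)/mapP => [[u du ->] | [o' /(mem_omega_coset n_ge3)[v dv ->] ->]].
  have [a ua aE] := lang F_alg0 eps0 (Defs.GL_unit u^-1).
  have uE : val u = (invmx (sigma_mx eps0 q0 a) *m a)%R.
    rewrite aE /= invmxM ?unitmx_inv ?Defs.GL_unit // invmxK -mulmxA mulVmx //.
    by rewrite mulmx1.
  have vG : in_GL eps0 q0 (sigma_mx eps q a *m invmx a)%R.
    by apply: (descent_in_GL ua (Defs.GL_unit u^-1) aE); rewrite (GL_fix u^-1).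
  pose v : Defs.GL n eps0 q0 := Sub _ vG.
  have ov := shintani_order n_ge3 k_gt0 qE epsE hl hl0 fE f0E ua uE (erefl _ : val v = _).
  have da0 : (\det a != 0)%R by rewrite -unitfE -unitmxE.
  have dE : (\det a / fix_sg (neg eps0) q0 (\det a) = l ^ i)%R.
    by rewrite -du uE det_mulmx det_inv det_sigma_mx mulrC.
  have dv : (\det (val v) = fix_sg (neg eps) q (\det a) / \det a)%R.
    by rewrite /= det_mulmx det_inv det_sigma_mx.
  have [v' dv' ov'] := @order_transfer i (\det a)%R v true da0 dE dv.
  exists #[f0 * inner v']; last by rewrite ov' ov.
  by apply/(mem_omega_coset n_ge3); exists v'.
(* For the lift, the determinant y of the future Lang element is fixed first, so that the lifted [u]
   gets determinant l^i. *)
have [y y0 yE] := lang_scalar eps0 q0 (li0 i).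
have [v' dv' <-] := @order_transfer i y v false y0 yE dv.
have [b0 ub0 b0E] := lang F_alg eps (Defs.GL_unit v'^-1).
have y_b0 : (\det b0 * y != 0)%R by rewrite mulf_neq0 // -unitfE -unitmxE.
(* The Lang element [b0] should have determinant y^-1; the discrepancy [x] is fixed by F1, so the
   dilation by x^-1 lies in the group fixed by F1 and does not disturb the Lang equation. *)
pose x := (\det b0 * y)%R.
have y_r : (fix_sg (neg eps) q (\det b0) = \det b0 * (y / fix_sg (neg eps) q y))%R.
  by rewrite -det_sigma_mx b0E det_mulmx /= det_inv dv' invf_div.
have xq : (fix_sg (neg eps) q x = x)%R.
  by rewrite /x fix_sgM y_r -mulrA divfK // fix_sg_eq0.
pose b := (dil_mx n x^-1 *m b0)%R.
have x'0 : (x^-1 != 0)%R by rewrite invr_eq0.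
have ub : b \in unitmx by rewrite unitmx_mul dil_mx_unit.
have [|w wE] := @dil_GL F n eps q x^-1 x'0; first by rewrite fix_sgV xq.
have bE : sigma_mx eps q b = (b *m val (v'^-1)%g)%R.
  rewrite sigma_mxM ?dil_mx_unit // -{1}wE GL_fix wE b0E mulmxA //.
have uG := descent_in_GL ub (Defs.GL_unit v'^-1) bE (GL_fix v'^-1).
pose u : Defs.GL n eps q := Sub _ uG.
have ua : invmx b \in unitmx by rewrite unitmx_inv.
have db : (\det b = y^-1)%R.
  rewrite det_mulmx det_dil_mx // /x invfM -mulrA mulrCA mulVf ?mulr1 //.
  by rewrite -unitfE -unitmxE.
have uE : val u = (invmx (sigma_mx eps0 q0 (invmx b)) *m invmx b)%R.
  by rewrite sigma_mxV // invmxK.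
have vE : val v' = (sigma_mx eps q (invmx b) *m invmx (invmx b))%R.
  rewrite sigma_mxV // bE invmxM ?Defs.GL_unit //= !invmxK mulmxKV //.
exists u; last by rewrite (shintani_order n_ge3 k_gt0 qE epsE hl hl0 fE f0E ua uE vE).
by rewrite uE det_mulmx !det_inv det_sigma_mx det_inv db invrK mulrC.
Qed.

End Main.

(** * Field and graph automorphisms *)

Section FieldGraph.

Variables (F : closedFieldType) (n : nat).

Lemma acts_phi eps (q r : char_power F) : acts (phi n eps q r) (@phi_mx F n r).
Proof.
have [Aphi phiE] := phiP n eps q r; split=> // g Sg.
exists (phi_GL r g); rewrite phiE //; split=> //.
by move: Sg; rewrite !inE /= det_map_mx => /eqP->; rewrite rmorph1.
Qed.

Lemma acts_tau eps (q : char_power F) : acts (tau n eps q) (@tau_mx F n).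
Proof.
have [Atau tauE] := tauP n eps q; split=> // g Sg.
exists (tau_GL g); rewrite tauE //; split=> //.
by move: Sg; rewrite !inE /= det_tr det_inv => /eqP->; rewrite invr1.
Qed.

Lemma acts_phi_exp eps (q p q0 : char_power F) d : q0 = (p ^ d)%N :> nat ->
  acts (phi n eps q p ^+ d) (@sigma_mx F n Plus q0).
Proof.
move=> q0E; apply: acts_ext (acts_iter d (acts_phi eps q p)) => s _ _.
by rewrite -[phi_mx p]/(sigma_mx Plus p) iter_sigma_mx /= -q0E.
Qed.

Lemma acts_phi_exp_tau eps (q p q0 : char_power F) d : q0 = (p ^ d)%N :> nat ->
  acts (phi n eps q p ^+ d * tau n eps q) (@sigma_mx F n Minus q0).
Proof.
move=> q0E; apply: acts_ext (acts_mul (acts_phi_exp eps q q0E) (acts_tau eps q)).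
by move=> s _ _; rewrite /= phi_tau_mx.
Qed.

Lemma acts_id_sigma (q q0 : char_power F) k eps eps0 : q = (q0 ^ k)%N :> nat ->
  neg eps = neg eps0 && odd k -> acts (1 : {perm coset_of 'Z(SL n eps0 q0)}) (@sigma_mx F n eps q).
Proof.
move=> qE epsE; apply: acts_ext (@acts_id F n eps0 q0) => s _ qs.
have epsE' : neg eps = (neg eps0 && odd k) (+) false by rewrite addbF.
by rewrite (sigma_on_fixed qE epsE' qs).
Qed.

Lemma acts_tau_sigma (q q0 : char_power F) k eps eps0 : q = (q0 ^ k)%N :> nat ->
  neg eps = ~~ (neg eps0 && odd k) -> acts (tau n eps0 q0) (@sigma_mx F n eps q).
Proof.
move=> qE epsE; apply: acts_ext (acts_tau eps0 q0) => s _ qs.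
have epsE' : neg eps = (neg eps0 && odd k) (+) true by rewrite addbT.
by rewrite (sigma_on_fixed qE epsE' qs).
Qed.

(** Descent with k = 1 between opposite signs: on each of the two groups, tau acts as the Frobenius
    map that defines the other. *)
Lemma omega_tau (q : char_power F) (l lU : F) (i : int)
    (hl : (q_sub_eps Plus q).-primitive_root%R l)
    (hlU : (q_sub_eps Minus q).-primitive_root%R lU) :
  (3 <= n)%N -> (forall x : F, exists2 N, (0 < N)%N & (x ^+ (q ^ N) = x)%R) ->
  omega (tau n Plus q * expgz (delta n hl) i *: Inn (PSL n Plus q)) =i
    omega (tau n Minus q * expgz (delta n hlU) i *: Inn (PSL n Minus q)).
Proof.
move=> n_ge3 F_alg o; have qE : q = (q ^ 1)%N :> nat by rewrite expn1.
rewrite (omega_descent n_ge3 (ltn0Sn 0) qE hlU hl F_alg F_alg (acts_tau_sigma qE _) (acts_tau_sigma qE _)) //.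
by rewrite /dilate (eq_map mul1n) map_id.
Qed.

End FieldGraph.

Theorem lemma3p3 (F : closedFieldType) (p q q0 : char_power F) (m k n : nat)
    (p_prime : prime p)
    (iota : {rmorphism 'F_p -> F}) (F_alg : forall x : F, algebraicOver iota x)
    (n_ge3 : (3 <= n)%N) (qE : q = (p ^ m)%N :> nat)
    (k_gt0 : (0 < k)%N) (k_dvd_m : (k %| m)%N) (q0E : q = (q0 ^ k)%N :> nat)
    (l lU l0 l0U : F)
    (hl : (q_sub_eps Plus q).-primitive_root%R l)
    (hlU : (q_sub_eps Minus q).-primitive_root%R lU)
    (hl0 : (q_sub_eps Plus q0).-primitive_root%R l0)
    (hl0U : (q_sub_eps Minus q0).-primitive_root%R l0U)
    (i : int) :
  let L := Inn (PSL n Plus q) in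
  let U := Inn (PSL n Minus q) in
  let L0 := Inn (PSL n Plus q0) in
  let U0 := Inn (PSL n Minus q0) in
  let betaL := phi n Plus q p ^+ (m %/ k) in
  let betaU := phi n Minus q p ^+ (m %/ k) in
  let tauL := tau n Plus q in
  let tauU := tau n Minus q in
  let tauL0 := tau n Plus q0 in
  let deltaL := expgz (delta n hl) i in
  let deltaU := expgz (delta n hlU) i in
  let deltaL0 := expgz (delta n hl0) i in
  let deltaU0 := expgz (delta n hl0U) i in
  [/\ omega (betaL * deltaL *: L) =i dilate k (omega (deltaL0 *: L0)),
      ~~ odd k ->
        omega (betaL * tauL * deltaL *: L) =i dilate k (omega (deltaU0 *: U0)),
      odd k ->
        omega (betaU * tauU * deltaU *: U) =i dilate k (omega (deltaU0 *: U0)),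
      odd k ->
        omega (betaL * tauL * deltaL *: L)
          =i dilate k (omega (tauL0 * deltaL0 *: L0))
    & omega (betaU * deltaU *: U)
        =i dilate k (omega (tauL0 * deltaL0 *: L0))]
  /\ omega (tauL * deltaL *: L) =i omega (tauU * deltaU *: U).
Proof.
move=> L U L0 U0 betaL betaU tauL tauU tauL0 deltaL deltaU deltaL0 deltaU0.
have q0_p : q0 = (p ^ (m %/ k))%N :> nat.
  by apply/eqP; rewrite -(eqn_exp2r _ _ k_gt0) -q0E -expnM divnK // qE.
have alg x := algebraic_fixed_frob p_prime qE (F_alg x).
have alg0 x := algebraic_fixed_frob p_prime q0_p (F_alg x).
split; last exact: omega_tau.
have betaLE := acts_phi_exp n Plus q q0_p.
have betaUE := acts_phi_exp n Minus q q0_p.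
have betatauLE := acts_phi_exp_tau n Plus q q0_p.
have betatauUE := acts_phi_exp_tau n Minus q q0_p.
have descent eps eps0 l1 l2 (h1 : (q_sub_eps eps q).-primitive_root%R l1)
    (h2 : (q_sub_eps eps0 q0).-primitive_root%R l2) f f0 fE f0E :=
  @omega_descent F n q q0 k eps eps0 l1 l2 n_ge3 k_gt0 q0E h1 h2 alg alg0 f f0 fE f0E i.
have one eps0 eps := @acts_id_sigma F n q q0 k eps eps0 q0E.
split=> [|k_even|k_odd|k_odd|].
- by have := descent _ _ _ _ hl hl0 _ _ betaLE (one Plus Plus erefl); rewrite mul1g.
- by have := descent _ _ _ _ hl hl0U _ _ betatauLE (one Minus Plus (esym (negPf k_even))); rewrite mul1g.
- by have := descent _ _ _ _ hlU hl0U _ _ betatauUE (one Minus Minus (esym k_odd)); rewrite mul1g.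
(* Since beta tau is the unitary Frobenius map over q0, the descent gives the tau-coset of U0;
   [omega_tau] over q0 exchanges it for that of L0. *)
- have tauE := acts_tau_sigma n (eps := Plus) (eps0 := Minus) q0E.
  move=> o; rewrite (descent _ _ _ _ hl hl0U _ _ betatauLE (tauE _)) ?k_odd //.
  by apply/mapP/mapP=> -[o' o'P ->]; exists o' => //; move: o'P; rewrite (omega_tau _ hl0 hl0U).
- have tauE := @acts_tau_sigma F n q q0 k Minus Plus q0E erefl.
  exact: (descent _ _ _ _ hlU hl0 _ _ betaUE tauE).
Qed.
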